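(* Let $\mu\subseteq\lambda$ be strict partitions. Then $$\omega\big(GP^{(\beta)}_{\lambda/\mu}\big)=GP^{(\beta)}_{\lambda/\mu}\big(\tfrac{x}{1-\beta x}\big)\qquad\text{and}\qquad\omega\big(GQ^{(\beta)}_{\lambda/\mu}\big)=GQ^{(\beta)}_{\lambda/\mu}\big(\tfrac{x}{1-\beta x}\big).$$
   Context: $f(\frac{x}{1-\beta x})$ denotes the power series obtained from $f\in\mathbb{Z}[\beta][[x_1,x_2,\dots]]$ by substituting $x_i\mapsto\frac{x_i}{1-\beta x_i}=x_i+\beta x_i^2+\cdots$ for every $i$. The involution $\omega$. Let $\mathfrak{m}\mathrm{QSym}$ be the module of all quasisymmetric power series (unbounded degree allowed) over $\mathbb{Z}[\beta]$, with pseudobasis (elements are arbitrary infinite linear combinations) the fundamental quasisymmetric functions $L_\alpha=\sum x_{i_1}\cdots x_{i_n}$, the sum over $i_1\le\cdots\le i_n$ with $i_j<i_{j+1}$ whenever $j\in I(\alpha)$, where $\alpha=(\alpha_1,\dots,\alpha_k)$ is a composition of $n$ and $I(\alpha)=\{\alpha_1,\alpha_1+\alpha_2,\dots,\alpha_1+\cdots+\alpha_{k-1}\}$. $\omega:\mathfrak{m}\mathrm{QSym}\to\mathfrak{m}\mathrm{QSym}$ is the continuous $\mathbb{Z}[\beta]$-linear map (i.e. commuting with infinite linear combinations of the $L_\alpha$) with $\omega(L_\alpha)=L_{\alpha^{\mathtt t}}$, where $\alpha^{\mathtt t}$ is the reversal of the composition $\alpha^{\mathtt c}$ of $n$ with $I(\alpha^{\mathtt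 c})=[n-1]\setminus I(\alpha)$. On symmetric functions it restricts to the usual involution $s_\lambda\mapsto s_{\lambda^T}$. $K$-theoretic Schur functions. A strict partition is $\lambda=(\lambda_1>\lambda_2>\cdots>0)$; $\mu\subseteq\lambda$ means $\mu_i\le\lambda_i$ for all $i$. $\mathsf{SD}_{\lambda/\mu}=\{(i,i+j-1)\in\mathbb{Z}_{>0}\times\mathbb{Z}_{>0}:\mu_i<j\le\lambda_i\}$ and $|\lambda/\mu|=|\lambda|-|\mu|$. Let $\mathbb{M}=\{1'<1<2'<2<\cdots\}$, $|i'|=|i|=i$. For finite nonempty $S,T\subset\mathbb{M}$ write $S\preceq T$ if $\max S\le\min T$, and $x^S=\prod_{i\in S}x_{|i|}$. A semistandard shifted set-valued tableau $T$ of shape $\lambda/\mu$ assigns to each box of $\mathsf{SD}_{\lambda/\mu}$ a finite nonempty subset of $\mathbb{M}$, weakly increasing in the sense of $\preceq$ along rows and columns, with no unprimed number twice in the same column and no primed number twice in the same row. With $|T|=\sum|T(i,j)|$ and $x^T=\prod x^{T(i,j)}$, $GQ^{(\beta)}_{\lambda/\mu}=\sum_T\beta^{|T|-|\lambda/\mu|}x^T$ over all such $T$, and $GP^{(\beta)}_{\lambda/\mu}$ is the same sum restricted to $T$ with $T(i,i)\subset\mathbb{Z}_{>0}$ whenever $(i,i)\in\mathsf{SD}_{\lambda/\mu}$. *)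

(* Defs.v *)
From HB Require Import structures.
From mathcomp Require Import all_boot all_order all_algebra finmap zify.
From mathcomp Require Import boolp classical_sets cardinality fsbigop.
From mathcomp Require Import monalg.

Set Implicit Arguments.
Unset Strict Implicit.
Unset Printing Implicit Defensive.

Import Order.TTheory GRing.Theory.

Local Open Scope classical_set_scope.
Local Open Scope ring_scope.

(** Variables are
    indexed from 0: index [i] stands for the variable usually called
    x_(i+1). *)

Definition beta : {poly int} := 'X.

Definition series := {cmonom nat} -> {poly int}.

Definition smono (m : {cmonom nat}) : series := fun n => (n == m)%:R.

Definition sscale (c : {poly int}) (f : series) : series := fun n => c * f n.

(** Infinite sum, coefficient by coefficient.  The finitely supported sum
    [\sum_(i \in A)] is 0 by convention on an infinite support; it is only
    used below for families in which every monomial occurs in finitely many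
    members. *)
Definition ssum (I : choiceType) (A : set I) (F : I -> series) : series :=
  fun n => \sum_(i \in A) F i n.

Definition smul (f g : series) : series :=
  fun n => \sum_(ab \in [set ab : {cmonom nat} * {cmonom nat} |
                           mmul ab.1 ab.2 = n]) f ab.1 * g ab.2.

Definition sone : series := smono (@mone _).

Definition sexp (f : series) (k : nat) : series := iter k (smul f) sone.

Definition meval (y : nat -> series) (m : {cmonom nat}) : series :=
  \big[smul/sone]_(i <- finsupp m) sexp (y i) (m i).

Definition ssubst (y : nat -> series) (f : series) : series :=
  ssum setT (fun m => sscale (f m) (meval y m)).

(** x_i / (1 - beta x_i) = sum_(k >= 0) beta^k x_i^(k+1) *)
Definition xgeom (i : nat) : series :=
  ssum setT (fun k : nat => sscale (beta ^+ k) (smono (expcmn (ucm i) k.+1))).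

Definition subst_geom (f : series) : series := ssubst xgeom f.

Definition is_comp (al : seq nat) : bool := 0%N \notin al.

Definition comp_set (al : seq nat) : seq nat :=
  [seq sumn (take k al) | k <- iota 1 (size al).-1].

(** The composition of n with [comp_set] equal to the increasing sequence D
    is read off from the successive differences of 0, D, n. *)
Definition comp_of_set (n : nat) (D : seq nat) : seq nat :=
  if n is 0%N then [::] else pairmap (fun a b => b - a)%N 0%N (rcons D n).

Definition comp_compl (al : seq nat) : seq nat :=
  comp_of_set (sumn al)
    [seq j <- iota 1 (sumn al).-1 | j \notin comp_set al].

Definition comp_tr (al : seq nat) : seq nat := rev (comp_compl al).

Definition word_mon (s : seq nat) : {cmonom nat} :=
  \big[mmul/@mone _]_(i <- s) ucm i.

(** Words i_1 ... i_n are 0-based sequences: i_j is [nth 0 s j.-1]. *)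
Definition Lword (al : seq nat) : set (seq nat) :=
  [set s | [/\ size s = sumn al, sorted leq s &
    forall j, j \in comp_set al -> (nth 0 s j.-1 < nth 0 s j)%N]].

Definition Lqsym (al : seq nat) : series :=
  ssum (Lword al) (fun s => smono (word_mon s)).

Definition Lcomb (c : seq nat -> {poly int}) (B : seq nat -> series) : series :=
  ssum [set al | is_comp al] (fun al => sscale (c al) (B al)).

(** The coefficients of f in the pseudobasis [Lqsym]; they are determined by
    f on compositions as soon as f is quasisymmetric.  If f is not
    quasisymmetric, [Lcoef f] is 0 and [omega f] = 0 by convention. *)
Definition Lcoef (f : series) : seq nat -> {poly int} :=
  xget (fun=> 0) [set c | f = Lcomb c Lqsym].

Definition omega (f : series) : series :=
  Lcomb (Lcoef f) (fun al => Lqsym (comp_tr al)).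

(** The next lemmas show that the [Lqsym al] are linearly independent, so that
    [omega] is the continuous linear map sending [Lqsym al] to
    [Lqsym (comp_tr al)] (lemma [omega_Lcomb]). *)

Lemma comp_of_setP n D : sorted ltn D -> all (fun j => 0 < j < n)%N D ->
  [/\ is_comp (comp_of_set n D), sumn (comp_of_set n D) = n &
      comp_set (comp_of_set n D) = D].
Proof.
case: n => [|n]; first by case: D => //= x s _ /andP[]; lia.
rewrite /comp_of_set; set s := rcons D n.+1 => sD aD.
have ps : path ltn 0%N s.
  rewrite /s rcons_path; apply/andP; split.
    by case: D sD aD {s} => //= x D -> /andP[/andP[-> _] _].
  by case/lastP: D sD aD {s} => // D y _; rewrite last_rcons all_rcons => /andP[/andP[]].
have sumP x t k : path ltn x t ->
    sumn (take k (pairmap (fun a b => b - a)%N x t)) = (last x (take k t) - x)%N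
    /\ (x <= last x (take k t))%N.
  elim: t x k => [|y t IH] x [|k] //=; rewrite ?subnn //.
  by move=> /andP[xy /(IH _ k)[-> h]]; split; lia.
have [E _] := sumP 0%N s (size s) ps.
have sz : size (pairmap (fun a b => b - a)%N 0%N s) = size s by rewrite size_pairmap.
rewrite -{1}sz !take_size subn0 {2}/s last_rcons in E.
split=> //.
  have posP x t : path ltn x t -> 0%N \notin pairmap (fun a b => b - a)%N x t.
    elim: t x => //= y t IH x /andP[xy /IH h].
    rewrite inE negb_or h andbT; lia.
  exact: posP.
rewrite /comp_set sz size_rcons /=.
apply: (@eq_from_nth _ 0%N); rewrite size_map size_iota // => i hi.
rewrite (nth_map 0%N) ?size_iota // nth_iota // add1n.
have [-> _] := sumP 0%N s i.+1 ps.
rewrite subn0 /s (take_nth 0%N) ?size_rcons; last by lia.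
by rewrite last_rcons nth_rcons hi.
Qed.

Lemma comp_complP al :
  [/\ is_comp (comp_compl al), sumn (comp_compl al) = sumn al &
      comp_set (comp_compl al) =
        [seq j <- iota 1 (sumn al).-1 | j \notin comp_set al]].
Proof.
apply: comp_of_setP.
  by apply: sorted_filter (iota_ltn_sorted _ _); exact: ltn_trans.
by apply/allP => j; rewrite mem_filter mem_iota => /andP[_]; lia.
Qed.

Lemma comp_setE al : [seq sumn (take k al) | k <- iota 1 (size al)] = scanl addn 0%N al.
Proof.
apply: (@eq_from_nth _ 0%N); rewrite size_map size_iota ?size_scanl // => i hi.
rewrite (nth_map 0%N) ?size_iota // nth_iota // add1n nth_scanl //.
by rewrite sumnE foldl_foldr //= ?foldrE; [rewrite unlock | exact: addnA|exact: addnC].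
Qed.

Lemma comp_setK al : is_comp al -> comp_of_set (sumn al) (comp_set al) = al.
Proof.
case: al => // x al; rewrite /is_comp inE negb_or => /andP[x0 _].
rewrite /comp_of_set; have -> : rcons (comp_set (x :: al)) (sumn (x :: al)) =
    scanl addn 0%N (x :: al).
  rewrite -comp_setE /comp_set; set t := x :: al.
  rewrite (_ : iota 1 (size t) = rcons (iota 1 (size t).-1) (size t)).
    by rewrite map_rcons take_size.
  by have := iotaD 1 (size al) 1; rewrite addn1 add1n cats1.
case E : (sumn (x :: al)) => [|n]; first by move: E x0 => /=; case: x.
by apply: (@scanlK _ _ (fun a b => b - a)%N) => a b; rewrite addKn.
Qed.

Lemma comp_set_sorted al : is_comp al ->
  sorted ltn (comp_set al) /\ all (fun j => 0 < j < sumn al)%N (comp_set al).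
Proof.
move=> cal; have h i j : (i < j <= size al)%N -> (sumn (take i al) < sumn (take j al))%N.
  move=> /andP[ij js]; rewrite -(subnKC (ltnW ij)) takeD sumn_cat -{1}[sumn _]addn0 ltn_add2l.
  have mem_leq (l : seq nat) y : y \in l -> (y <= sumn l)%N.
    by elim: l => //= z l IHl; rewrite inE => /predU1P[->|/IHl]; lia.
  have yt : nth 0%N al i \in take (j - i) (drop i al).
    have e : nth 0%N al i = nth 0%N (take (j - i) (drop i al)) 0.
      by rewrite nth_take ?subn_gt0 // nth_drop addn0.
    by rewrite e mem_nth // size_takel ?size_drop ?subn_gt0 // leq_sub2r.
  apply: leq_trans (mem_leq _ _ yt); rewrite lt0n; apply/eqP => y0.
  by move: cal; rewrite /is_comp -y0 (mem_drop (mem_take yt)).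
split.
  rewrite /comp_set sorted_map.
  apply: (@sub_in_sorted _ (fun k => 0 < k < size al)%N ltn).
  - move=> i j hi hj /= ij; move: hi hj; rewrite !unfold_in => hi hj; apply: h; lia.
  - by apply/allP => j; rewrite mem_iota; lia.
  - exact: iota_ltn_sorted.
apply/allP => _ /mapP[k kI ->]; rewrite mem_iota in kI.
have := h 0%N k; have := h k (size al); rewrite take0 take_size /=; lia.
Qed.

Lemma word_monE s i : word_mon s i = count_mem i s.
Proof.
rewrite /word_mon; elim: s => [|x s IH]; first by rewrite big_nil cm1.
by rewrite big_cons cmM IH cmU.
Qed.

Lemma word_mon_inj s t : sorted leq s -> sorted leq t -> word_mon s = word_mon t -> s = t.
Proof.
move=> ss st E; apply: (sorted_eq leq_trans anti_leq ss st).
by apply/allP => x _ /=; rewrite -!word_monE E.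
Qed.

Lemma Lqsym_word w al : sorted leq w -> Lqsym al (word_mon w) = (`[< Lword al w >])%:R.
Proof.
move=> sw; rewrite /Lqsym /ssum /smono; case: asboolP => hw.
  transitivity (\sum_(s \in [set w]) ((word_mon w == word_mon s)%:R : {poly int})).
    apply/esym/fsbig_widen.
    - by move=> _ ->.
    - move=> s [[_ ss _] /= ne]; case: eqP => // /(word_mon_inj sw ss) e.
      by case: ne.
  by rewrite fsbig_set1 eqxx.
rewrite fsbig1 // => s hs; case: eqP => // e; case: hw.
by rewrite (word_mon_inj sw _ e) //; case: hs.
Qed.

Definition aword al := mkseq (fun p => count (fun d => d <= p)%N (comp_set al)) (sumn al).

Lemma aword_sorted al : sorted leq (aword al).
Proof.
rewrite /aword /mkseq sorted_map; apply: sub_sorted (iota_sorted 0 _) => i j ij /=.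
by apply: sub_count => d /= h; lia.
Qed.

Lemma aword_Lword al ga : is_comp al -> is_comp ga ->
  Lword ga (aword al) <-> sumn ga = sumn al /\ {subset comp_set ga <= comp_set al}.
Proof.
move=> cal cga; have [sD aD] := comp_set_sorted cal; have [sE aE] := comp_set_sorted cga.
have key j : (0 < j < sumn al)%N ->
    (nth 0 (aword al) j.-1 < nth 0 (aword al) j)%N = (j \in comp_set al).
  move=> hj; rewrite !nth_mkseq; try lia.
  have -> : count (fun d => d <= j)%N (comp_set al) =
      (count (fun d => d <= j.-1)%N (comp_set al) + count_mem j (comp_set al))%N.
    rewrite -count_predUI -[LHS]addn0; congr addn.
      by apply: eq_count => d /=; lia.
    by apply/esym/eqP; rewrite -leqn0 leqNgt -has_count; apply/hasPn => d _ /=; lia.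
  by rewrite -[X in (X < _)%N]addn0 ltn_add2l -has_count has_pred1.
split=> [[sz _ h]|[sz h]].
  rewrite size_mkseq in sz; split=> // j jE; rewrite -key ?h //.
  by rewrite sz; exact: (allP aE).
split; rewrite ?size_mkseq ?aword_sorted // => j jE; rewrite key ?h //.
by rewrite -sz; exact: (allP aE).
Qed.

Lemma finite_comp n : finite_set [set al | is_comp al /\ sumn al = n].
Proof.
apply: (@sub_finite_set _ _ [set` [seq comp_of_set n (mask (t : (n.-1).-tuple bool) (iota 1 n.-1)) | t <- enum {: (n.-1).-tuple bool}]]); last exact: finite_seq.
move=> al [cal <-] /=; have [sD aD] := comp_set_sorted cal.
apply/mapP; set m := [seq j \in comp_set al | j <- iota 1 (sumn al).-1].
have sm : size m == (sumn al).-1 by rewrite size_map size_iota.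
exists (Tuple sm); rewrite ?mem_enum //= /m -filter_mask -{1}(comp_setK cal); congr comp_of_set.
apply: (irr_sorted_eq ltn_trans ltnn) => //.
  by apply: sorted_filter (iota_ltn_sorted _ _); exact: ltn_trans.
move=> j; rewrite mem_filter mem_iota; case jD: (j \in _) => //=.
by have := allP aD _ jD; lia.
Qed.

Lemma Lcomb_aword c al : is_comp al -> Lcomb c Lqsym (word_mon (aword al)) =
  \sum_(ga \in [set ga | is_comp ga /\ Lword ga (aword al)]) c ga.
Proof.
move=> cal; rewrite /Lcomb /ssum /sscale.
have -> : [set ga | is_comp ga /\ Lword ga (aword al)] =
   [set ga | is_comp ga] `&` [set ga | Lword ga (aword al)] by [].
rewrite fsbig_mkcondr; apply: eq_fsbigr => ga _.
rewrite Lqsym_word ?aword_sorted //; case: ifPn; rewrite ?inE ?notin_setE /= => h.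
  by rewrite asboolT ?mulr1.
by rewrite asboolF ?mulr0.
Qed.

Lemma Lqsym_free c d : Lcomb c Lqsym = Lcomb d Lqsym ->
  forall al, is_comp al -> c al = d al.
Proof.
move=> E al; have [n] := ubnP (size al); elim: n al => // n IH al sn cal.
have := congr1 (fun f => f (word_mon (aword al))) E; rewrite !Lcomb_aword //.
set A := [set ga | _].
have finA : finite_set A.
  by apply: sub_finite_set (finite_comp (sumn al)) => ga [cga /(aword_Lword cal cga)[]].
have Aal : A al by rewrite /A /=; split; [exact: cal | exact: ((aword_Lword cal cal).2 (conj erefl (fun _ h => h)))].
rewrite (fsbigD1 al A c finA Aal) (fsbigD1 al A d finA Aal).
rewrite (eq_fsbigr d); first by move=> /addIr.
move=> ga; rewrite inE => -[[cga /(aword_Lword cal cga)[sz sub]] ne]; apply: IH => //.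
have [sD _] := comp_set_sorted cal; have [sE _] := comp_set_sorted cga.
have uE := sorted_uniq ltn_trans ltnn sE.
have le := uniq_leq_size uE sub.
have ne2 : (size (comp_set ga) != size (comp_set al)).
  apply/eqP => e; apply: ne; rewrite /= -(comp_setK cga) -(comp_setK cal) sz; congr comp_of_set.
  apply: (irr_sorted_eq ltn_trans ltnn) => //.
  by have [] := uniq_min_size uE sub; rewrite ?e.
move: le ne2; rewrite !size_map !size_iota; lia.
Qed.

Lemma omega_Lcomb c : omega (Lcomb c Lqsym) = Lcomb c (fun al => Lqsym (comp_tr al)).
Proof.
have h : Lcomb c Lqsym = Lcomb (Lcoef (Lcomb c Lqsym)) Lqsym.
  by apply: (@xgetPex _ _ [set c' | Lcomb c Lqsym = Lcomb c' Lqsym]); exists c.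
rewrite /omega /Lcomb; apply/funext => n; apply: eq_fsbigr => al; rewrite inE /= => cal.
by rewrite /sscale -(Lqsym_free h cal).
Qed.

(** In shifted diagrams rows and columns are indexed
    from 0; the diagonal is still the set of boxes (i, i). *)

Definition strict_partition (la : seq nat) : bool :=
  sorted gtn la && (0%N \notin la).

Definition part_sub (mu la : seq nat) : Prop :=
  forall i, (nth 0 mu i <= nth 0 la i)%N.

Definition SD (la mu : seq nat) : {fset nat * nat} :=
  [fset b in [seq (i, (i + j)%N) | i <- iota 0 (size la),
                j <- index_iota (nth 0%N mu i) (nth 0%N la i)]]%fset.

Lemma in_SD la mu b : (b \in SD la mu) =
  (b.1 <= b.2)%N && (nth 0 mu b.1 <= b.2 - b.1 < nth 0 la b.1)%N.
Proof.
rewrite !inE /=; apply/allpairsPdep/idP => [[i [j [hi hj ->]]] /=|].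
  by move: hj; rewrite mem_index_iota addKn leq_addr.
move=> /andP[h h2]; exists b.1, (b.2 - b.1)%N.
rewrite mem_index_iota h2 subnKC // mem_iota /= add0n; split=> //.
  rewrite ltnNge; apply/negP => hs; move: h2; rewrite (nth_default _ hs); lia.
by case: b h h2.
Qed.

(** [primed i] < [unprimed i] < [primed i.+1] < ... *)
Definition letter := (nat *l bool)%type.
Definition primed (i : nat) : letter := (i, false).
Definition unprimed (i : nat) : letter := (i, true).

Lemma letter_leE (a b : letter) :
  (a <= b)%O = (a.1 < b.1)%N || (a.1 == b.1) && (a.2 ==> b.2).
Proof.
case: a b => [i p] [j q]; rewrite Order.ProdLexiOrder.leEprodlexi /= !leEnat.
by case: ltngtP => //=; case: p q => [] [].
Qed.

(** For nonempty S and T this is max S <= min T. *)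
Definition set_le (S T : {fset letter}) : Prop :=
  forall a b, a \in S -> b \in T -> (a <= b)%O.

Definition filling (la mu : seq nat) := {ffun SD la mu -> {fset letter}}.

Definition is_set_valued_tableau (la mu : seq nat) (T : filling la mu) : Prop :=
  [/\ forall u, T u != fset0,
      forall u v, (val u).1 = (val v).1 -> ((val u).2 < (val v).2)%N ->
        set_le (T u) (T v),
      forall u v, (val u).2 = (val v).2 -> ((val u).1 < (val v).1)%N ->
        set_le (T u) (T v),
      forall u v i, u != v -> (val u).2 = (val v).2 ->
        ~ (unprimed i \in T u /\ unprimed i \in T v) &
      forall u v i, u != v -> (val u).1 = (val v).1 ->
        ~ (primed i \in T u /\ primed i \in T v)].

Definition unprimed_diagonal (la mu : seq nat) (T : filling la mu) : Prop :=
  forall u a, (val u).1 = (val u).2 -> a \in T u -> a.2 = true.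

Definition tab_size (la mu : seq nat) (T : filling la mu) : nat :=
  (\sum_u #|` T u|)%N.

Definition tab_mon (la mu : seq nat) (T : filling la mu) : {cmonom nat} :=
  \big[mmul/@mone _]_u \big[mmul/@mone _]_(a <- T u) ucm a.1.

Definition tab_term (la mu : seq nat) (T : filling la mu) : series :=
  sscale (beta ^+ (tab_size T - (sumn la - sumn mu))) (smono (tab_mon T)).

Definition GQ (la mu : seq nat) : series :=
  ssum [set T : filling la mu | is_set_valued_tableau T] (@tab_term la mu).

Definition GP (la mu : seq nat) : series :=
  ssum [set T : filling la mu |
         is_set_valued_tableau T /\ unprimed_diagonal T] (@tab_term la mu).

(* Main.v *)
Require Import Defs.
From HB Require Import structures.
From mathcomp Require Import all_boot all_order all_algebra finmap ring zify.
From mathcomp Require Import boolp classical_sets cardinality fsbigop functions.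
From mathcomp Require Import monalg.

Set Implicit Arguments.
Unset Strict Implicit.
Unset Printing Implicit Defensive.

(** A shifted set-valued tableau is read as a sequence of steps (letter,
    content): for each letter [k'] the contents decrease, then for the letter [k]
    they increase.  At a step of content [c] one may add the letter to the unique
    box of content [c] which is, or becomes, a maximal box of the current order
    ideal of nonempty boxes.  So the coefficient of [x^m] in GP or GQ is a matrix
    entry of [b_(m 0) b_(m 1) ...], where [b_k] is the coefficient of [x^k] in
    [B(x) = h_n(x) ... h_1(x) h_0(x) h_1(x) ... h_n(x)] (with [h_0(x)^2] in the
    middle for GQ), [h_c(x) = 1 + x u_c], and the operators [u_c] satisfy
    [u_c^2 = beta u_c], commute when far apart, and kill the products
    [u_c u_d u_c] with [|c - d| = 1] except [u_0 u_1 u_0].  By the Yang-Baxter and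
    reflection equations of Fomin and Kirillov the [B(x)] commute.

    For a series whose coefficients are of this form, [omega] replaces [B(x)] by
    [B(-x)^(-1)] and reverses the order of the variables, which is harmless since
    the [B(x)] commute.  As [u_c^2 = beta u_c], the inverse of [1 - x u_c] is
    [1 + (x / (1 - beta x)) u_c]; since the word of contents is a palindrome,
    [B(-x)^(-1) = B(x / (1 - beta x))]. *)

Import Order.TTheory GRing.Theory.

(** * Corners of order ideals in shifted skew shapes *)

Section Shape.

Variables la mu : seq nat.
Hypotheses (hla : strict_partition la) (hmu : strict_partition mu).

Notation box := (SD la mu).
Implicit Types (u v b : box) (J : {set box}).

Definition row u := (val u).1.
Definition col u := (val u).2.
Definition cont u := (col u - row u)%N.

(** Parts drop by at least one per row until they vanish, so among nonzero parts [i + nth 0 l i],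
    the column just past row [i], weakly decreases with [i]. *)
Lemma strict_nth l i j : strict_partition l -> (i <= j)%N ->
  nth 0 l j = 0%N \/ (nth 0 l j + (j - i) <= nth 0 l i)%N.
Proof.
move=> /andP[/(sortedP 0%N) sl _] ij.
have step k : nth 0 l k.+1 = 0%N \/ (nth 0 l k.+1 < nth 0 l k)%N.
  by case: (ltnP k.+1 (size l)) => h; [right; exact: sl | left; exact: nth_default].
elim: j ij => [|j IH]; first by rewrite leqn0 => /eqP->; right; rewrite subnn addn0.
rewrite leq_eqVlt => /predU1P[->|]; first by right; rewrite subnn addn0.
by rewrite ltnS => /IH; have := step j; lia.
Qed.

Lemma row_le_col u : (row u <= col u)%N.
Proof. by have := valP u; rewrite in_SD => /andP[]. Qed.

Lemma box_eq u v : row u = row v -> col u = col v -> u = v.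
Proof.
by move=> hr hc; apply: val_inj; move: hr hc; rewrite /row /col; do 2!case: (val _) => ? ? /= ; move=> -> ->.
Qed.

Lemma cont_row_inj u v : cont u = cont v -> row u = row v -> u = v.
Proof.
move=> hc hr; apply: box_eq => //; have := row_le_col u; have := row_le_col v.
by move: hc; rewrite /cont hr; lia.
Qed.

Lemma col_contE u : col u = (cont u + row u)%N.
Proof. by have := row_le_col u; rewrite /cont; lia. Qed.

(** Both ends of a row, at [r + mu_r] and [r + la_r], move weakly left going down. Where [mu_r = 0]
    the row starts on the diagonal instead, whence the condition [r <= c]. *)
Lemma box_convex u v r c : (row u <= r <= row v)%N -> (col u <= c <= col v)%N ->
  (r <= c)%N -> exists w : box, row w = r /\ col w = c.
Proof.
move=> hr hc rc.
suff h : (r, c) \in SD la mu by exists [` h]%fset.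
have := valP u; have := valP v; rewrite !in_SD -!/(row _) -!/(col _) /= rc /=.
move=> /andP[h1 /andP[h2 h3]] /andP[h4 /andP[h5 h6]].
have /(strict_nth hmu)[] : (row u <= r)%N by lia.
  all: have /(strict_nth hla)[] : (r <= row v)%N by lia.
all: lia.
Qed.

(** Only boxes in a common row or column are compared, as in the tableau conditions; the relation
    need not be transitive. *)
Definition below u v : bool :=
  (row u == row v) && (col u < col v)%N || (col u == col v) && (row u < row v)%N.

Lemma below_irr u : below u u = false.
Proof. by rewrite /below !ltnn !andbF. Qed.

Definition ideal J : bool := [forall u, forall v, (v \in J) && below u v ==> (u \in J)].

(** Being an ideal is part of the condition, so a set that is not an ideal has no corners and its
    column in [umx] below is zero. *)
Definition is_corner c J b : bool :=
  [&& ideal J, b \in J, cont b == c & [forall v, (v \in J) ==> ~~ below b v]].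

Lemma idealP J : reflect (forall u v, v \in J -> below u v -> u \in J) (ideal J).
Proof.
apply: (iffP idP) => [/forallP h u v vJ uv|h].
  by have /forallP/(_ v) := h u; rewrite vJ uv.
by apply/forallP => u; apply/forallP => v; apply/implyP => /andP[]; exact: h.
Qed.

Lemma is_cornerP c J b : reflect
  [/\ ideal J, b \in J, cont b = c & forall v, v \in J -> ~~ below b v] (is_corner c J b).
Proof.
apply: (iffP and4P) => [[h1 h2 /eqP h3 h4]|[h1 h2 /eqP h3 h4]]; split=> //; last first.
  by apply/forallP => v; apply/implyP; exact: h4.
by move=> v vJ; have /forallP/(_ v) := h4; rewrite vJ.
Qed.

Lemma ideal_corner c J b : is_corner c J b -> ideal (J :\ b).
Proof.
move=> /is_cornerP[/idealP iJ bJ _ mb]; apply/idealP => u v; rewrite !inE => /andP[vb vJ] uv.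
rewrite (iJ _ _ vJ uv) andbT; apply/eqP => ub; subst u.
by move: (mb _ vJ); rewrite uv.
Qed.

(** A box [b'] of [J] further down the diagonal of [b] would bring into [J] the box in the row of
    [b] and the column of [b'], which lies to the right of [b]. *)
Lemma corner_same_content J b b' : ideal J -> b \in J -> b' \in J -> cont b = cont b' ->
  (forall v, v \in J -> ~~ below b v) -> (row b' <= row b)%N.
Proof.
move=> /idealP iJ bJ b'J e mb; have := row_le_col b; have := row_le_col b'.
move: e; rewrite /cont leqNgt => e h1 h2; apply/negP => h.
have [w [wr wc]] : exists w : box, row w = row b /\ col w = col b'.
  by apply: (@box_convex b b'); lia.
have wJ : w \in J by apply: (iJ _ _ b'J); rewrite /below; lia.
by have := mb _ wJ; rewrite /below; lia.
Qed.

Lemma corner_uniq c J b b' : is_corner c J b -> is_corner c J b' -> b = b'.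
Proof.
move=> /is_cornerP[iJ bJ cb mb] /is_cornerP[_ b'J cb' mb'].
have h := corner_same_content iJ bJ b'J (etrans cb (esym cb')) mb.
have h' := corner_same_content iJ b'J bJ (etrans cb' (esym cb)) mb'.
have := row_le_col b; have := row_le_col b'; move: cb cb'; rewrite /cont => cb cb' r r'.
by apply: box_eq; lia.
Qed.

(** The other boxes of content [c] in [J] lie higher up the diagonal, and each keeps to its right
    the box in the column of [b]. This gives [u_c ^ 2 = beta u_c]. *)
Lemma corner_once c J b b' : is_corner c J b -> ~~ is_corner c (J :\ b) b'.
Proof.
move=> /is_cornerP[iJ bJ cb mb]; apply/negP => /is_cornerP[iJ' b'J cb' mb'].
move: b'J; rewrite !inE => /andP[b'b b'J].
have h := corner_same_content iJ bJ b'J (etrans cb (esym cb')) mb.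
move: (cb) (cb'); rewrite /cont => cb1 cb1'.
have rb := row_le_col b; have rb' := row_le_col b'.
have lt : (row b' < row b)%N.
  rewrite ltn_neqAle h andbT.
  by apply: contraNneq b'b => e; apply/eqP/cont_row_inj => //; rewrite cb.
have [w [wr wc]] : exists w : box, row w = row b' /\ col w = col b.
  by apply: (@box_convex b' b); lia.
have wJ : w \in J :\ b.
  rewrite !inE; apply/andP; split; first by apply/eqP => e; move: wr; rewrite e; lia.
  by move/idealP: iJ => iJ; apply: (iJ _ _ bJ); rewrite /below; lia.
by have := mb' _ wJ; rewrite /below; lia.
Qed.

(** If removing [b] makes [b'] maximal, no box lies between them, so they are adjacent. Hence
    removing a corner can only create corners of neighbouring contents. *)
Lemma below_cover J b b' : ideal J -> b \in J -> below b' b ->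
  (forall v, v \in J :\ b -> ~~ below b' v) -> (cont b' == (cont b).-1) || (cont b' == (cont b).+1).
Proof.
move=> /idealP iJ bJ bb mb.
have rb := row_le_col b; have rb' := row_le_col b'; rewrite /cont.
have nw (w : box) : below w b -> ~~ below b' w.
  move=> wb; apply: mb; rewrite !inE (iJ _ _ bJ wb) andbT.
  by apply: contraTneq wb => ->; rewrite below_irr.
case/orP: (bb) => /andP[/eqP e lt].
  case: (ltngtP (col b').+1 (col b)) => [h||]; [|lia|lia].
  have [w [wr wc]] : exists w : box, row w = row b /\ col w = (col b').+1.
    by apply: (@box_convex b' b); lia.
  by have := nw w; rewrite /below; lia.
case: (ltngtP (row b').+1 (row b)) => [h||]; [|lia|lia].
have [w [wr wc]] : exists w : box, row w = (row b').+1 /\ col w = col b.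
  by apply: (@box_convex b' b); lia.
by have := nw w; rewrite /below; lia.
Qed.

Lemma corner_far c d J b b' : (c.+1 < d)%N || (d.+1 < c)%N -> is_corner c J b ->
  is_corner d (J :\ b) b' = is_corner d J b'.
Proof.
move=> cd hb; have iJb := ideal_corner hb; move/is_cornerP: hb => [iJ bJ cb mb].
apply/is_cornerP/is_cornerP => -[_ b'J cb' mb'].
  split=> //; first by move: b'J; rewrite inE => /andP[].
  move=> v vJ; case: (eqVneq v b) => [->|vb]; last by apply: mb'; rewrite !inE vb.
  by apply/negP => bb; have := below_cover iJ bJ bb mb'; lia.
split=> //; last by move=> v; rewrite inE => /andP[_]; exact: mb'.
by rewrite !inE b'J andbT; apply: contraTneq cd => e; move: cb'; rewrite e cb; lia.
Qed.

(** If two boxes of adjacent contents are incomparable, the box in the row of the upper one and the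
    column of the lower one is in [J] and to the right of the upper one. *)
Lemma corner_adjacent c d J b b' : (d == c.+1) || (c == d.+1) -> is_corner c J b ->
  ~~ is_corner d J b'.
Proof.
wlog cd : c d b b' / d = c.+1.
  move=> H /orP[/eqP e|/eqP e] hb; first by apply: (H c d b) => //; rewrite e eqxx.
  by apply/negP => hb'; have := H d c b' b e; rewrite hb hb' e eqxx => /(_ isT isT).
move=> _ /is_cornerP[/idealP iJ bJ cb mb]; apply/negP => /is_cornerP[_ b'J cb' mb'].
have := mb _ b'J; have := mb' _ bJ; move: cb cb'; rewrite /cont /below => cb cb' n1 n2.
have rb := row_le_col b; have rb' := row_le_col b'.
case: (ltnP (row b) (row b')) => h.
  have [w [wr wc]] : exists w : box, row w = row b /\ col w = col b'.
    by apply: (@box_convex b b'); lia.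
  have wJ : w \in J by apply: (iJ _ _ b'J); rewrite /below; lia.
  by have := mb _ wJ; rewrite /below; lia.
have [w [wr wc]] : exists w : box, row w = row b' /\ col w = col b.
  by apply: (@box_convex b' b); lia.
have wJ : w \in J by apply: (iJ _ _ bJ); rewrite /below; lia.
by have := mb' _ wJ; rewrite /below; lia.
Qed.

(** The box [b3] is northwest of [b1] on the same diagonal. The two other vertices of the rectangle
    they span lie between them, so each would have to be the removed box [b2]. They are distinct, so
    one is missing: the southwest one, below the main diagonal. *)
Lemma corner_braid c d J b1 b2 b3 : (d == c.+1) || (c == d.+1) ->
  is_corner c J b1 -> is_corner d (J :\ b1) b2 -> is_corner c (J :\ b1 :\ b2) b3 ->
  c = 0%N /\ d = 1%N.
Proof.
move=> cd h1 h2 h3.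
have /is_cornerP[iJ b1J c1 m1] := h1; have /is_cornerP[iJ' b2J c2 m2] := h2.
have /is_cornerP[iJ'' b3J c3 m3] := h3.
move: b2J b3J; rewrite !inE => /andP[n21 b2J] /and3P[n32 n31 b3J].
have := corner_same_content iJ b1J b3J; rewrite c1 c3 => /(_ erefl m1) r31.
have rb1 := row_le_col b1; have rb3 := row_le_col b3.
have e1 := col_contE b1; have e2 := col_contE b2; have e3 := col_contE b3.
rewrite c1 in e1; rewrite c2 in e2; rewrite c3 in e3; clear h1 h2 h3.
have lt : (row b3 < row b1)%N.
  by rewrite ltn_neqAle r31 andbT; apply: contraNneq n31 => e; apply/eqP/cont_row_inj => //; rewrite c1.
have mid (w : box) : below b3 w -> below w b1 -> w = b2.
  move=> w3 w1; apply/eqP; apply: contraTT w3 => w2; apply: m3; rewrite !inE w2 /=.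
  move/idealP: iJ => iJ; rewrite (iJ _ _ b1J w1) andbT.
  by apply: contraTneq w1 => ->; rewrite below_irr.
have [w [wr wc]] : exists w : box, row w = row b3 /\ col w = col b1.
  by apply: (@box_convex b3 b1); clear - rb1 rb3 e1 e3 lt; lia.
have wb2 : w = b2.
  by apply: mid; rewrite /below wr wc ?eqxx ?lt ?orbT //=; clear - rb1 rb3 e1 e3 lt; lia.
have e4 : d = (c + (row b1 - row b3))%N by rewrite -wb2 wr wc in e2; clear - e1 e2 lt; lia.
(* By [e4] and [cd], [row b1 = row b3 + 1]. If this exceeds [col b3 = c + row b3], then [c = 0]. *)
case: (leqP (row b1) (col b3)) => h; last by clear - cd rb1 rb3 e1 e3 lt h e4; lia.
have [w' [wr' wc']] : exists w : box, row w = row b1 /\ col w = col b3.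
  by apply: (@box_convex b3 b1); clear - rb1 rb3 e1 e3 lt h; lia.
have wb2' : w' = b2.
  by apply: mid; rewrite /below wr' wc' ?eqxx ?lt ?orbT //=; clear - rb1 rb3 e1 e3 lt h; lia.
by move: wr wr'; rewrite wb2 wb2' => -> e; rewrite e ltnn in lt.
Qed.

Definition corner c J : option box := [pick b | is_corner c J b].

Lemma cornerS c J b : is_corner c J b -> corner c J = Some b.
Proof.
move=> hb; rewrite /corner; case: pickP => [b' hb'|/(_ b)]; last by rewrite hb.
by rewrite (corner_uniq hb hb').
Qed.

Lemma cornerN c J : (forall b, ~~ is_corner c J b) -> corner c J = None.
Proof. by move=> h; rewrite /corner; case: pickP => // b; rewrite (negPf (h b)). Qed.

Variant corner_spec c J : option box -> Type :=
  | CornerSome b of is_corner c J b : corner_spec c J (Some b)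
  | CornerNone of (forall b, ~~ is_corner c J b) : corner_spec c J None.

Lemma cornerP c J : corner_spec c J (corner c J).
Proof.
rewrite /corner; case: pickP => [b|] h; constructor => // b.
by rewrite h.
Qed.

End Shape.

(** * Tableaux one step at a time *)

Definition step : Type := (letter * nat)%type.

(* The order in which the (letter, content) pairs are processed: primed letters
   by decreasing content, unprimed letters by increasing content. *)
Definition slt (s t : step) : bool :=
  (s.1.1 < t.1.1)%N || (s.1.1 == t.1.1) &&
    (if s.1.2 then t.1.2 && (s.2 < t.2)%N else t.1.2 || (t.2 < s.2)%N).

Lemma slt_irr s : slt s s = false.
Proof. by rewrite /slt !ltnn eqxx; case: s.1.2. Qed.

Lemma slt_asym s t : slt s t -> slt t s = false.
Proof. by rewrite /slt; case: s.1.2; case: t.1.2 => /=; lia. Qed.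

Section Tableaux.

Variables la mu : seq nat.
Hypotheses (hla : strict_partition la) (hmu : strict_partition mu).

Notation box := (SD la mu).
Implicit Types (u v b : box) (J : {set box}) (T : filling la mu) (a : letter).

Definition lcount T (i : nat) : nat := (\sum_u \sum_(a <- T u) (a.1 == i))%N.

Definition add_letter T b a : filling la mu := [ffun u => if u == b then a |` T u else T u]%fset.
Definition rem_letter T b a : filling la mu := [ffun u => if u == b then T u `\ a else T u]%fset.

Lemma add_letterE T b a u a' : (a' \in add_letter T b a u) = (u == b) && (a' == a) || (a' \in T u).
Proof. by rewrite ffunE; case: eqP => // _; rewrite !inE. Qed.

Lemma rem_letterE T b a u a' : (a' \in rem_letter T b a u) = ~~ ((u == b) && (a' == a)) && (a' \in T u).
Proof. by rewrite ffunE; case: eqP => // _; rewrite !inE. Qed.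

Lemma rem_letterK T b a : a \in T b -> add_letter (rem_letter T b a) b a = T.
Proof.
move=> aT; apply/ffunP => u; apply/fsetP => a'; rewrite add_letterE rem_letterE.
by case: eqP => // ->; case: eqP => // ->; rewrite aT.
Qed.

Lemma add_letterK T b a : a \notin T b -> rem_letter (add_letter T b a) b a = T.
Proof.
move=> aT; apply/ffunP => u; apply/fsetP => a'; rewrite rem_letterE add_letterE.
by case: (u =P b) => //= ->; case: (a' =P a) => //= ->; rewrite (negPf aT).
Qed.

Lemma lcount_add T b a i : a \notin T b ->
  lcount (add_letter T b a) i = ((a.1 == i) + lcount T i)%N.
Proof.
move=> aT; rewrite /lcount (bigD1 b) //= [in RHS](bigD1 b) //= addnA; congr addn.
  by rewrite ffunE eqxx big_fsetU1.
by apply: eq_bigr => u /negPf ub; rewrite ffunE ub.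
Qed.

Lemma tab_size_add T b a : a \notin T b -> tab_size (add_letter T b a) = (tab_size T).+1.
Proof.
move=> aT; rewrite /tab_size (bigD1 b) //= [in RHS](bigD1 b) //= -addSn; congr addn.
  by rewrite ffunE eqxx cardfsU1 aT.
by apply: eq_bigr => u /negPf ub; rewrite ffunE ub.
Qed.

(** Tableaux in a form from which steps can be peeled off. Contents grow along rows and shrink down
    columns, so [tab_slt] encodes at once the weak increase and both bans on repeated letters. *)
Record is_tab (W : seq step) J (f : nat -> nat) T : Prop := IsTab {
  tab_ideal : ideal J;
  tab_supp : forall u, (T u != fset0) = (u \in J);
  tab_step : forall u a, a \in T u -> (a, cont u) \in W;
  tab_slt : forall u v a a', below u v -> a \in T u -> a' \in T v ->
    slt (a, cont u) (a', cont v);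
  tab_lcount : forall i, lcount T i = f i }.

Definition tabs W J f : set (filling la mu) := [set T | is_tab W J f T].

Lemma tab_memJ W J f T u a : is_tab W J f T -> a \in T u -> u \in J.
Proof. by move=> hT aT; rewrite -(tab_supp hT); apply/fset0Pn; exists a. Qed.

(** Makes the truncated subtraction in the exponent of [gen] exact. *)
Lemma tab_size_ge W J f T : is_tab W J f T -> (#|J| <= tab_size T)%N.
Proof.
move=> hT; rewrite -sum1_card big_mkcond /=; apply: leq_sum => u _.
by case: ifP => // uJ; rewrite cardfs_gt0 (tab_supp hT).
Qed.

Definition decr (f : nat -> nat) (k i : nat) : nat := (f i - (i == k))%N.

Section OneStep.

Variables (W : seq step) (a : letter) (c : nat).
Let t : step := (a, c).
Hypothesis Wt : all (slt^~ t) W.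

Lemma tNW : t \notin W.
Proof. by apply/negP => /(allP Wt); rewrite slt_irr. Qed.

(** A letter in a box beyond [b] would need a step after [t], which is the last one. *)
Lemma tab_corner J f T b : is_tab (rcons W t) J f T -> a \in T b -> cont b = c ->
  is_corner c J b.
Proof.
move=> hT aT cb; apply/is_cornerP; split=> //; first exact: (tab_ideal hT).
  exact: (tab_memJ hT aT).
move=> v; rewrite -(tab_supp hT) => /fset0Pn[a' a'T]; apply/negP => bv.
have := tab_slt hT bv aT a'T; have := tab_step hT a'T; rewrite cb mem_rcons inE.
by move=> /predU1P[->|/(allP Wt) h]; rewrite ?slt_irr // slt_asym.
Qed.

Lemma tab_widen J f T : is_tab W J f T -> is_tab (rcons W t) J f T.
Proof.
case=> h1 h2 h3 h4 h5; split=> // u a' /h3.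
by rewrite mem_rcons inE orbC => ->.
Qed.

Lemma tab_notin J f T b : is_tab W J f T -> cont b = c -> a \notin T b.
Proof. by move=> hT cb; apply: contra tNW => /(tab_step hT); rewrite cb. Qed.

(** With [J' = J] the letter joins a box already filled; with [J' = J :\ b] it opens the box [b]. *)
Lemma tab_add J J' f T b : is_corner c J b -> J' = J \/ J' = J :\ b ->
  (0 < f a.1)%N -> is_tab W J' (decr f a.1) T -> is_tab (rcons W t) J f (add_letter T b a).
Proof.
move=> hb hJ' fa hT; have /is_cornerP[iJ bJ cb mb] := hb.
have JJ u : (u \in J) = (u == b) || (u \in J').
  by case: hJ' => ->; rewrite ?inE; case: eqP => // ->; rewrite bJ.
split=> //.
- move=> u; rewrite JJ ffunE; case: (u == b) => /=; last exact: (tab_supp hT).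
  by apply/fset0Pn; exists a; rewrite !inE eqxx.
- move=> u a'; rewrite add_letterE mem_rcons inE => /orP[/andP[/eqP-> /eqP->]|].
    by rewrite cb eqxx.
  by move/(tab_step hT) => ->; rewrite orbT.
- move=> u v a1 a2 uv; rewrite !add_letterE => /orP[/andP[/eqP ub _]|a1T].
    move=> h; have : v \in J.
      rewrite JJ; case/orP: h => [/andP[-> //]|/(tab_memJ hT)->]; exact: orbT.
    by move/mb; rewrite -ub uv.
  move=> /orP[/andP[/eqP-> /eqP->]|a2T]; last exact: (tab_slt hT uv a1T a2T).
  by rewrite cb; apply: (allP Wt); exact: (tab_step hT a1T).
move=> i; rewrite lcount_add ?(tab_notin hT) // (tab_lcount hT) /decr.
by move: fa; case: (a.1 =P i) => [<-|]; case: (i =P a.1) => //; lia.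
Qed.

Lemma tab_rem J f T b : is_tab (rcons W t) J f T -> is_corner c J b -> a \in T b ->
  (0 < f a.1)%N /\
  (is_tab W J (decr f a.1) (rem_letter T b a) \/
   is_tab W (J :\ b) (decr f a.1) (rem_letter T b a)).
Proof.
move=> hT hb aT; have /is_cornerP[iJ bJ cb mb] := hb.
have cnt i : lcount T i = ((a.1 == i) + lcount (rem_letter T b a) i)%N.
  by rewrite -{1}(rem_letterK aT) lcount_add // rem_letterE !eqxx.
have fa : (0 < f a.1)%N by rewrite -(tab_lcount hT) cnt eqxx.
split=> //.
have steps u a' : a' \in rem_letter T b a u -> (a', cont u) \in W.
  rewrite rem_letterE => /andP[n a'T]; have := tab_step hT a'T.
  rewrite mem_rcons inE => /predU1P[[ea ec]|//].
  rewrite ea in a'T n; have hu := tab_corner hT a'T ec.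
  by move: n; rewrite (corner_uniq hla hmu hu hb) !eqxx.
have slts u v a1 a2 : below u v -> a1 \in rem_letter T b a u -> a2 \in rem_letter T b a v ->
    slt (a1, cont u) (a2, cont v).
  by move=> uv; rewrite !rem_letterE => /andP[_ h1] /andP[_ h2]; exact: (tab_slt hT uv h1 h2).
have lcs i : lcount (rem_letter T b a) i = decr f a.1 i.
  by rewrite /decr -(tab_lcount hT) cnt eq_sym addKn.
case: (eqVneq (rem_letter T b a b) fset0) => e; [right|left]; split=> //.
- exact: ideal_corner hb.
- move=> u; rewrite !inE; case: (eqVneq u b) => [->|ub] /=; first by rewrite e eqxx.
  by rewrite ffunE (negPf ub) (tab_supp hT).
- move=> u; case: (eqVneq u b) => [->|ub]; first by rewrite e bJ.
  by rewrite ffunE (negPf ub) (tab_supp hT).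
Qed.

Lemma tab_unused J f T : is_tab (rcons W t) J f T ->
  (forall b, is_corner c J b -> a \notin T b) -> is_tab W J f T.
Proof.
move=> hT n; have [h1 h2 h3 h4 h5] := hT; split=> // u a' a'T.
have := h3 _ _ a'T; rewrite mem_rcons inE => /predU1P[[ea ec]|//].
by rewrite ea in a'T; have := n _ (tab_corner hT a'T ec); rewrite a'T.
Qed.

Lemma tabs_rcons_corner J f b : is_corner c J b -> (0 < f a.1)%N ->
  tabs (rcons W t) J f = (tabs W J f `|` (fun T => add_letter T b a) @`
    (tabs W J (decr f a.1) `|` tabs W (J :\ b) (decr f a.1)))%classic.
Proof.
move=> hb fa; rewrite eqEsubset; split=> [T hT|T [/tab_widen//|[T' [hT'|hT'] <-]]].
- case: (boolP (a \in T b)) => aT; last first.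
    by left; apply: (tab_unused hT) => b' /(corner_uniq hla hmu hb) <-.
  by right; exists (rem_letter T b a); [exact: (tab_rem hT hb aT).2 | exact: rem_letterK].
- have h : is_tab W J (decr f a.1) T' := hT'.
  by apply: (tab_add hb _ fa h) => //; left.
- have h : is_tab W (J :\ b) (decr f a.1) T' := hT'.
  by apply: (tab_add hb _ fa h) => //; right.
Qed.

Lemma tabs_rcons_none J f : (forall b, is_corner c J b -> f a.1 = 0%N) ->
  tabs (rcons W t) J f = tabs W J f.
Proof.
move=> hb; rewrite eqEsubset; split=> T; last exact: tab_widen.
move=> hT; apply: (tab_unused hT) => b cb; apply/negP => aT.
by have [] := tab_rem hT cb aT; rewrite (hb _ cb).
Qed.

End OneStep.

Lemma tabs_nil J f T : is_tab [::] J f T -> T = [ffun=> fset0].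
Proof.
move=> hT; apply/ffunP => u; rewrite ffunE; apply/fsetP => a; rewrite inE.
by apply/negP => /(tab_step hT).
Qed.

Lemma tabs_finite W J f : pairwise slt W -> finite_set (tabs W J f).
Proof.
elim/last_ind: W J f => [|W [a c] IH] J f.
  by move=> _; apply: (@sub_finite_set _ _ [set [ffun=> fset0]]%classic) => // T /tabs_nil.
rewrite pairwise_rcons => /andP[Wt pW]; have IH' := IH _ _ pW.
case: (posnP (f a.1)) => fa; first by rewrite (tabs_rcons_none Wt).
case: (pickP (is_corner c J)) => [b hb|n].
  rewrite (tabs_rcons_corner Wt hb fa) finite_setU; split=> //.
  by apply: finite_image; rewrite finite_setU; split.
by rewrite (tabs_rcons_none Wt) // => b; rewrite n.
Qed.

Local Open Scope ring_scope.

Definition gen W J f : {poly int} := \sum_(T \in tabs W J f) beta ^+ (tab_size T - #|J|).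

Lemma gen_rcons W a c J f : pairwise slt (rcons W (a, c)) ->
  gen (rcons W (a, c)) J f = gen W J f +
    (if (0 < f a.1)%N then
       if corner c J is Some b then
         beta * gen W J (decr f a.1) + gen W (J :\ b) (decr f a.1)
       else 0
     else 0).
Proof.
rewrite pairwise_rcons => /andP[Wt pW]; have fin J' f' := tabs_finite J' f' pW.
case: (posnP (f a.1)) => fa; first by rewrite /gen (tabs_rcons_none Wt) // addr0.
case: (cornerP c J) => [b hb|n]; last first.
  by rewrite /gen (tabs_rcons_none Wt) ?addr0 // => b hb; have := n b; rewrite hb.
have /is_cornerP[iJ bJ cb mb] := hb.
rewrite /gen (tabs_rcons_corner Wt hb fa) fsbigU0 //; first last.
- move=> T [hT [T' _ e]]; have := tab_notin Wt hT cb.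
  by rewrite -e add_letterE !eqxx.
- by apply: finite_image; rewrite finite_setU; split.
congr (_ + _); rewrite fsbig_image; last first.
  move=> T T'; rewrite !inE => hT hT' e.
  have nT T1 : is_tab W J (decr f a.1) T1 \/ is_tab W (J :\ b) (decr f a.1) T1 -> a \notin T1 b.
    by case=> /(tab_notin Wt); apply.
  by rewrite -(add_letterK (nT _ hT)) e (add_letterK (nT _ hT')).
rewrite fsbigU0 //; last first.
  by move=> T [hT /tab_supp/(_ b)]; rewrite (tab_supp hT) !inE bJ eqxx.
congr (_ + _).
  rewrite mulr_fsumr; apply: eq_fsbigr => T; rewrite inE => hT.
  by rewrite -exprS tab_size_add ?(tab_notin Wt hT cb) // subSn // (tab_size_ge hT).
apply: eq_fsbigr => T; rewrite inE => hT.
rewrite tab_size_add ?(tab_notin Wt hT cb) // (cardsD1 b J) bJ add1n subSS //.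
Qed.

End Tableaux.

Local Open Scope ring_scope.

(** * The reflection equation *)

Section ReflectionEquation.

Variables (K : comNzRingType) (E : algType K) (beta : K).

Definition lincomb (ws : seq E) (p : {poly K}) : E :=
  \sum_(i < size ws) p`_i *: ws`_i.

Lemma lincombD ws p q : lincomb ws p + lincomb ws q = lincomb ws (p + q).
Proof.
by rewrite -big_split; apply: eq_bigr => i _; rewrite /= coefD scalerDl.
Qed.

Lemma lincombZ ws c p : c *: lincomb ws p = lincomb ws (c%:P * p).
Proof. by rewrite scaler_sumr; apply: eq_bigr => i _; rewrite coefCM scalerA. Qed.

Lemma lincombX ws i : (i < size ws)%N -> ws`_i = lincomb ws 'X^i.
Proof.
move=> hi; rewrite /lincomb (bigD1 (Ordinal hi)) //= coefXn eqxx scale1r big1 ?addr0 //.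
by move=> j; rewrite coefXn -val_eqE /= => /negPf->; rewrite scale0r.
Qed.

Definition hfac (x : K) (u : E) : E := 1 + x *: u.

Section TwoGenerators.

Variables u v : E.
Hypotheses (uu : u * u = beta *: u) (vv : v * v = beta *: v) (vuv : v * u * v = 0).

(** These words span the algebra generated by [u] and [v]: the relations reduce squares and kill
    [v * u * v]. *)
Let ws := [:: 1; u; v; u * v; v * u; u * v * u].
Let w0 : 1 = lincomb ws 'X^0. Proof. exact: (@lincombX ws 0). Qed.
Let w1 : u = lincomb ws 'X^1. Proof. exact: (@lincombX ws 1). Qed.
Let w2 : v = lincomb ws 'X^2. Proof. exact: (@lincombX ws 2). Qed.
Let w3 : u * v = lincomb ws 'X^3. Proof. exact: (@lincombX ws 3). Qed.
Let w4 : v * u = lincomb ws 'X^4. Proof. exact: (@lincombX ws 4). Qed.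
Let w5 : u * v * u = lincomb ws 'X^5. Proof. exact: (@lincombX ws 5). Qed.

Let uuA a : a * u * u = beta *: (a * u). Proof. by rewrite -mulrA uu scalerAr. Qed.
Let vvA a : a * v * v = beta *: (a * v). Proof. by rewrite -mulrA vv scalerAr. Qed.
Let vuvA a : a * v * u * v = 0. Proof. by rewrite -mulrA -mulrA (mulrA v) vuv mulr0. Qed.

(* Words in [u] and [v] become monomials of [{poly K}], where [ring] applies. *)
Ltac expand :=
  rewrite /hfac; do ?[rewrite !(mulrDl, mulrDr, mul1r, mulr1)];
  rewrite -?(scalerAl, scalerAr) ?mulrA;
  do 6? [rewrite -?(scalerAl, scalerAr) ?(mul1r, mulr1) ?scalerA ?(uuA, vvA, vuvA) ?(uu, vv, vuv) ?scaler0 ?mul0r].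

Ltac collect :=
  rewrite ?w5 ?w3 ?w4 ?w2 ?w1 ?w0 ?lincombZ ?(addr0, add0r) ?lincombD; congr lincomb.

(** The middle parameter is the one of [hfac x w * hfac y w] when [w * w = beta *: w], a sum in the
    multiplicative formal group law. *)
Lemma yang_baxter x y : u * v * u = 0 ->
  hfac x u * hfac (x + y + beta * x * y) v * hfac y u =
  hfac y v * hfac (x + y + beta * x * y) u * hfac x v.
Proof.
move=> uvu; expand. rewrite uvu ?scaler0. collect; ring.
Qed.

(** This is [yang_baxter] with [u] and [v] exchanged and second parameter [(y - x) / (1 + beta x)],
    whose formal group sum with [x] is [y], cleared of denominators. *)
Lemma yang_baxter_div x y : u * v * u = 0 ->
  hfac x v * hfac y u * ((1 + beta * x)%:A + (y - x) *: v) =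
  ((1 + beta * x)%:A + (y - x) *: u) * hfac y v * hfac x u.
Proof.
move=> uvu; expand. rewrite uvu ?scaler0. collect; ring.
Qed.

Lemma reflection_base x y a b :
  let s := x + y + beta * x * y in
  s * b * (1 + beta * x) = (y - x) * b + a * (1 + beta * x) * s +
    a * (y - x) + beta * s * a * (y - x) + beta * a * b * (y - x) ->
  hfac a u * hfac s v * hfac b u * ((1 + beta * x)%:A + (y - x) *: v) =
  ((1 + beta * x)%:A + (y - x) *: v) * hfac b u * hfac s v * hfac a u.
Proof.
rewrite /= => h; expand; collect.
set s := x + y + beta * x * y in h *; set r := RHS in h.
(* The two sides differ by a multiple of [v * u - u * v], and the scalar is the difference of the
   two sides of the hypothesis. *)
suff e : (s * b * (1 + beta * x) - r)%:P * ('X^4 - 'X^3) = 0 :> {poly K}.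
  by apply/eqP; rewrite -subr_eq0 -e /r /s; apply/eqP; ring.
by rewrite h subrr mul0r.
Qed.
End TwoGenerators.

End ReflectionEquation.

Section Dressing.

Variables (K : comNzRingType) (E : algType K) (beta : K).
Variables (u : nat -> E) (p : K -> K).
Hypothesis uu : forall c, u c * u c = beta *: u c.
Hypothesis far : forall c d, (c.+1 < d)%N -> u c * u d = u d * u c.
Hypothesis udu : forall c, u c.+1 * u c * u c.+1 = 0.
Hypothesis dud : forall c, u c.+1 * u c.+2 * u c.+1 = 0.
(* Satisfied by [p x = x] and by [p x = x + x + beta * x * x], that is, by the
   middle factors [h_0(x)] and [h_0(x) ^ 2]. *)
Hypothesis hp : forall x y,
  let s := x + y + beta * x * y in
  s * p y * (1 + beta * x) = (y - x) * p y + p x * (1 + beta * x) * s +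
    p x * (y - x) + beta * s * p x * (y - x) + beta * p x * p y * (y - x).

Fixpoint dress (n : nat) (x : K) : E :=
  if n is n'.+1 then hfac x (u n'.+1) * dress n' x * hfac x (u n'.+1)
  else hfac (p x) (u 0%N).

(* [h_c] at the parameter [(y - x) / (1 + beta x)], with denominator cleared. *)
Let gfac x y c := (1 + beta * x)%:A + (y - x) *: u c.

Lemma dress_far n x c : (n.+1 < c)%N -> dress n x * u c = u c * dress n x.
Proof.
have hc y i : (i.+1 < c)%N -> hfac y (u i) * u c = u c * hfac y (u i).
  by move=> ic; rewrite mulrDl mulrDr mulr1 mul1r -scalerAl -scalerAr far.
elim: n => [|n IH] nc /=; first exact: hc.
by rewrite -mulrA hc // mulrA -(mulrA (hfac _ _)) IH ?(ltnW nc) // !mulrA hc.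
Qed.

Lemma hfac_gfac x y c : hfac x (u c) * gfac x y c = (1 + beta * x) *: hfac y (u c).
Proof.
rewrite /hfac /gfac mulrDl !mulrDr !mul1r -!(scalerAl, scalerAr) uu mulr1 !scalerA.
rewrite -!addrA -!scalerDl scalerDr scalerA; congr (_ + _ *: _); ring.
Qed.

Lemma gfac_hfac x y c : gfac x y c * hfac x (u c) = (1 + beta * x) *: hfac y (u c).
Proof.
rewrite /hfac /gfac mulrDl !mulrDr !mulr1 -!(scalerAl, scalerAr) uu mul1r !scalerA.
rewrite -!addrA -!scalerDl scalerDr scalerA; congr (_ + _ *: _); ring.
Qed.

(** Induction on [n]. Yang-Baxter rewrites the three middle factors, and the outer ones pass through
    [dress n]. Then [yang_baxter_div] lowers the index of [gfac] so that the induction hypothesis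
    applies, and the same moves are undone with [x] and [y] exchanged. *)
Lemma reflection n x y :
  dress n x * hfac (x + y + beta * x * y) (u n.+1) * dress n y * gfac x y n.+1 =
  gfac x y n.+1 * dress n y * hfac (x + y + beta * x * y) (u n.+1) * dress n x.
Proof.
elim: n => [|n IH] /=.
  by apply: reflection_base (hp x y); rewrite ?uu ?udu.
set k := n.+1 in IH *; set s := x + y + beta * x * y in IH *.
have far_dress z t : dress n z * hfac t (u k.+1) = hfac t (u k.+1) * dress n z.
  by rewrite mulrDl mulrDr mulr1 mul1r -scalerAl -scalerAr dress_far.
have yb z t : hfac z (u k) * hfac (z + t + beta * z * t) (u k.+1) * hfac t (u k) =
    hfac t (u k.+1) * hfac (z + t + beta * z * t) (u k) * hfac z (u k.+1).
  by apply: yang_baxter; rewrite ?uu ?udu ?dud.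
have ybd1 : hfac x (u k.+1) * hfac y (u k) * gfac x y k.+1 =
    gfac x y k * hfac y (u k.+1) * hfac x (u k).
  by apply: yang_baxter_div; rewrite ?uu ?udu ?dud.
have ybd2 : hfac x (u k) * hfac y (u k.+1) * gfac x y k =
    gfac x y k.+1 * hfac y (u k) * hfac x (u k.+1).
  by apply: yang_baxter_div; rewrite ?uu ?udu ?dud.
transitivity (hfac x (u k) * dress n x *
    (hfac x (u k) * hfac s (u k.+1) * hfac y (u k)) * dress n y * hfac y (u k) * gfac x y k.+1).
  by rewrite !mulrA.
rewrite yb !mulrA -(mulrA _ (dress n x)) far_dress mulrA.
rewrite -(mulrA _ (hfac x (u k.+1)) (dress n y)) -far_dress.
transitivity (hfac x (u k) * hfac y (u k.+1) * dress n x * hfac s (u k) * dress n y *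
    (hfac x (u k.+1) * hfac y (u k) * gfac x y k.+1)); first by rewrite !mulrA.
rewrite ybd1.
transitivity (hfac x (u k) * hfac y (u k.+1) *
    (dress n x * hfac s (u k) * dress n y * gfac x y k) * hfac y (u k.+1) * hfac x (u k)).
  by rewrite !mulrA.
rewrite IH !mulrA ybd2.
have es : s = y + x + beta * y * x by rewrite /s; ring.
have := yb y x; rewrite -es => ybs.
transitivity (gfac x y k.+1 * hfac y (u k) * dress n y *
  (hfac y (u k) * hfac s (u k.+1) * hfac x (u k)) * dress n x * hfac x (u k)); last first.
  by rewrite !mulrA.
rewrite ybs !mulrA -(mulrA _ (dress n y) (hfac x (u k.+1))) far_dress !mulrA.
by rewrite -(mulrA _ (hfac y (u k.+1)) (dress n x)) -far_dress !mulrA.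
Qed.

(** In the product of the two dressed factors the inner [a x * a y] merge into [hfac s], and
    [(1 + beta x) a y] is [gfac] times [a x]; what lies between the outer [a x] is the left side of
    [reflection]. *)
Lemma dress_comm_scaled n x y :
  (1 + beta * x) *: (dress n x * dress n y) = (1 + beta * x) *: (dress n y * dress n x).
Proof.
case: n => [|n] /=.
  rewrite /hfac !(mulrDl, mulrDr, mul1r, mulr1) -!(scalerAl, scalerAr) uu !scalerA.
  by rewrite -!addrA (addrCA (p x *: _)) (mulrC (p x) (p y)).
set a := fun z => hfac z (u n.+1); set s := x + y + beta * x * y.
have hh z t : a z * a t = hfac (z + t + beta * z * t) (u n.+1).
  rewrite /a /hfac mulrDl !mulrDr !mul1r !mulr1 -!(scalerAl, scalerAr) uu !scalerA.
  by rewrite -!addrA -!scalerDl; congr (_ + _ *: _); ring.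
transitivity (a x * (dress n x * hfac s (u n.+1) * dress n y * gfac x y n.+1) * a x).
  by rewrite -hh -!mulrA gfac_hfac /a -!scalerAr; congr (_ *: _).
rewrite reflection (_ : x + y + beta * x * y = y + x + beta * y * x); last by ring.
by rewrite !mulrA hfac_gfac -hh -!scalerAl !mulrA.
Qed.

End Dressing.

(** * The substitution x / (1 - beta x) *)

Section GeometricSubstitution.

Variables (K : comNzRingType) (beta : K).

Definition conv (f g : nat -> K) (n : nat) : K := \sum_(i < n.+1) f i * g (n - i)%N.

Definition geom (n : nat) : K := if n is n'.+1 then beta ^+ n' else 0.

(* [gcoef k n] is the coefficient of [x ^ n] in [(x / (1 - beta x)) ^ k]. *)
Definition gcoef (k : nat) : nat -> K := iter k (conv geom) (fun n => (n == 0%N)%:R).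

#[local] Arguments gcoef : simpl never.

Lemma gcoef0S k : gcoef k.+1 0 = 0.
Proof. by rewrite /gcoef iterS /conv big_ord1 mul0r. Qed.

Lemma gcoefSS k n : gcoef k.+1 n.+1 = gcoef k n + beta * gcoef k.+1 n.
Proof.
rewrite /gcoef iterS -/(gcoef k) /conv big_ord_recl mul0r add0r big_ord_recl /= expr0 mul1r.
rewrite subSS subn0 [X in _ = _ + beta * X]big_ord_recl /= mul0r add0r mulr_sumr.
by congr (_ + _); apply: eq_bigr => i _; rewrite /bump /= !add1n exprS mulrA subSS.
Qed.

Lemma gcoef_gt k n : (n < k)%N -> gcoef k n = 0.
Proof.
elim: n k => [|n IH] [|k] //; first by rewrite gcoef0S.
by rewrite ltnS => nk; rewrite gcoefSS !IH ?mulr0 ?addr0 // ltnW.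
Qed.

Variable E : algType K.

(** The noncommutative elementary symmetric polynomial of degree [k] in the letters of [w]. *)
Fixpoint ecoef (w : seq E) (k : nat) : E :=
  if w is u :: w' then ecoef w' k + (if k is k'.+1 then u * ecoef w' k' else 0)
  else (k == 0%N)%:R.

Lemma ecoef0 w : ecoef w 0 = 1.
Proof. by elim: w => //= u w ->; rewrite addr0. Qed.

Lemma ecoef_rcons w u k :
  ecoef (rcons w u) k = ecoef w k + (if k is k'.+1 then ecoef w k' * u else 0).
Proof.
elim: w k => [|v w IH] k.
  by case: k => [|[|k]] /=; rewrite ?(mulr1, mul1r, mulr0, mul0r).
rewrite /= IH; case: k => [|k]; rewrite ?addr0 //= IH.
case: k => [|k]; first by rewrite !addr0 -!addrA (addrC (_ * u)).
by rewrite mulrDr mulrDl -!addrA mulrA; congr (_ + _); rewrite addrCA.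
Qed.

Lemma ecoef_gt w k : (size w < k)%N -> ecoef w k = 0.
Proof.
elim: w k => [|u w IH] [|k] //= h; rewrite !IH ?mulr0 ?addr0 //; exact: ltnW.
Qed.

Lemma ecoef_prod w x : \prod_(u <- w) hfac x u = \sum_(k < (size w).+1) x ^+ k *: ecoef w k.
Proof.
elim: w => [|u w IH]; first by rewrite big_nil big_ord1 scale1r.
rewrite big_cons IH /hfac mulrDl mul1r [in RHS]/=.
under [RHS]eq_bigr do rewrite scalerDr.
rewrite big_split /=; congr (_ + _).
  by rewrite [RHS]big_ord_recr /= (ecoef_gt (ltnSn _)) scaler0 addr0.
rewrite [RHS]big_ord_recl /= scaler0 add0r mulr_sumr; apply: eq_bigr => i _.
by rewrite /bump /= add1n exprS -scalerAl -scalerAr scalerA.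
Qed.

(** The coefficients of [B(x / (1 - beta x))] when [b] gives those of [B(x)]. *)
Definition geom_coef (b : nat -> E) (n : nat) : E := \sum_(k < n.+1) gcoef k n *: b k.

Lemma geom_coefE b n N : (n <= N)%N -> geom_coef b n = \sum_(k < N.+1) gcoef k n *: b k.
Proof.
move=> nN; rewrite /geom_coef (big_ord_widen N.+1 (fun k => gcoef k n *: b k)) //.
rewrite big_mkcond; apply: eq_bigr => k _; rewrite ltnS.
by case: leqP => // h; rewrite gcoef_gt ?scale0r.
Qed.

(** The coefficient of [x ^ n] in [B(-x) Z(x)]. *)
Definition altconv (b Z : nat -> E) (n : nat) : E :=
  \sum_(i < n.+1) (-1) ^+ i * (b i * Z (n - i)%N).

(** The last factor [1 - x u] of the product moves over to [Z]. *)
Lemma altconv_rcons w u Z n : altconv (ecoef (rcons w u)) Z n =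
  altconv (ecoef w) (fun m => Z m - (if m is m'.+1 then u * Z m' else 0)) n.
Proof.
rewrite /altconv.
under eq_bigr do rewrite ecoef_rcons mulrDl mulrDr.
under [RHS]eq_bigr do rewrite mulrDr mulrDr.
rewrite !big_split /=; congr (_ + _).
rewrite big_ord_recl /= mul0r mulr0 add0r [RHS]big_ord_recr /= subnn oppr0 !mulr0 addr0.
apply: eq_bigr => i _; rewrite /bump /= add1n.
have -> : (n - i = (n - i.+1).+1)%N by have := ltn_ord i; lia.
by rewrite exprS !mulrN !mulNr mul1r mulrA !mulrA.
Qed.

Lemma geom_coef_cons w u n : u * u = beta *: u ->
  let Z := geom_coef (ecoef (u :: w)) in
  Z n - (if n is m.+1 then u * Z m else 0) = geom_coef (ecoef w) n.
Proof.
(* Let [g = x / (1 - beta x)] and let [W] have coefficients [ecoef w]. Then [S] gives the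
   coefficients of [g W(g)], and [SS] below is the relation [g = x + beta x g]. With
   [u * u = beta *: u] it turns [u * Z m] into [u * S m.+1]. *)
move=> uu Z; pose S m := \sum_(k < m.+1) gcoef k.+1 m *: ecoef w k.
have ZE m : Z m = geom_coef (ecoef w) m + u * S m.
  rewrite /Z /geom_coef /=; under eq_bigr do rewrite scalerDr.
  rewrite big_split /=; congr (_ + _); rewrite big_ord_recl /= scaler0 add0r.
  rewrite /S big_ord_recr /= gcoef_gt // scale0r addr0 mulr_sumr.
  by apply: eq_bigr => i _; rewrite /bump /= add1n -scalerAr.
have SS m : S m.+1 = geom_coef (ecoef w) m + beta *: S m.
  rewrite /S big_ord_recr /= gcoef_gt // scale0r addr0 scaler_sumr -big_split.
  by apply: eq_bigr => i _; rewrite gcoefSS scalerDl scalerA.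
case: n => [|n]; first by rewrite ZE /S big_ord1 gcoef0S scale0r mulr0 subr0 addr0.
by rewrite !ZE SS !mulrDr mulrA uu -scalerAr -scalerAl addrK.
Qed.

(* In generating functions: [1 + (x / (1 - beta x)) u] is inverse to [1 - x u]
   as soon as [u ^ 2 = beta u]. *)
Lemma altconv_geom_coef w n : (forall u, u \in w -> u * u = beta *: u) ->
  altconv (ecoef w) (geom_coef (ecoef (rev w))) n = (n == 0%N)%:R.
Proof.
elim/last_ind: w n => [|w u IH] n uu.
  rewrite /altconv big_ord_recl /= big1 ?addr0; last first.
    by move=> i _; rewrite /= mul0r mulr0.
  rewrite expr0 !mul1r subn0 /geom_coef big_ord_recl /= big1 ?addr0; last first.
    by move=> i _; rewrite scaler0.
  by rewrite /gcoef /=; case: n => [|n] /=; rewrite ?scale1r ?scale0r.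
rewrite rev_rcons altconv_rcons -(IH n); last first.
  by move=> v vw; apply: uu; rewrite mem_rcons inE vw orbT.
by apply: eq_bigr => i _; rewrite geom_coef_cons // uu // mem_rcons mem_head.
Qed.

End GeometricSubstitution.

(** * Transfer matrices *)

Section Transfer.

Variables la mu : seq nat.
Hypotheses (hla : strict_partition la) (hmu : strict_partition mu).

Notation box := (SD la mu).
Implicit Types (J : {set box}).

(** The predecessor is taken so that square matrices of size [nstates.+1] form a ring. *)
Definition nstates := #|{set box}|.-1.

Lemma nstatesE : nstates.+1 = #|{set box}|.
Proof. by rewrite prednK //; apply/card_gt0P; exists finset.set0. Qed.

Definition st (i : 'I_nstates.+1) : {set box} := enum_val (cast_ord nstatesE i).
Definition idx J : 'I_nstates.+1 := cast_ord (esym nstatesE) (enum_rank J).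

Lemma idxK : cancel idx st.
Proof. by move=> J; rewrite /st /idx cast_ordKV enum_rankK. Qed.

Lemma stK : cancel st idx.
Proof. by move=> i; rewrite /st /idx enum_valK cast_ordK. Qed.

(** The operator [u_c], acting on the right of row vectors indexed by all sets of boxes. Column [J]
    lists the possible supports before a letter is put in the corner of [J]. *)
Definition umx (c : nat) : 'M[{poly int}]_nstates.+1 :=
  \matrix_(i, j) if corner c (st j) is Some b
    then beta * (i == j)%:R + (i == idx (st j :\ b))%:R else 0.

Lemma mul_umx p (M : 'M_(p, nstates.+1)) c i J :
  (M *m umx c) i (idx J) =
  if corner c J is Some b then beta * M i (idx J) + M i (idx (J :\ b)) else 0.
Proof.
rewrite mxE; under eq_bigr do rewrite mxE idxK.
case: (corner c J) => [b|]; last by rewrite big1 // => k _; rewrite mulr0.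
under eq_bigr do rewrite mulrDr; rewrite big_split /=; congr (_ + _).
  rewrite (bigD1 (idx J)) //= eqxx mulr1 mulrC big1 ?addr0 //.
  by move=> k /negPf->; rewrite !mulr0.
rewrite (bigD1 (idx (J :\ b))) //= eqxx mulr1 big1 ?addr0 //.
by move=> k /negPf->; rewrite mulr0.
Qed.

Lemma mx_idxP p (A B : 'M[{poly int}]_(p, nstates.+1)) :
  (forall i J, A i (idx J) = B i (idx J)) -> A = B.
Proof. by move=> h; apply/matrixP => i j; rewrite -(stK j). Qed.

Lemma corner_onceE c J b : is_corner c J b -> corner c (J :\ b) = None.
Proof. by move=> hb; apply: cornerN => b'; exact: (corner_once hla hmu _ hb). Qed.

Lemma corner_farE c d J b : (c.+1 < d)%N || (d.+1 < c)%N -> is_corner c J b ->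
  corner d (J :\ b) = corner d J.
Proof.
move=> cd hb; case: (cornerP d J) => [b' h'|n].
  by apply: (cornerS hla hmu); rewrite (corner_far hla hmu _ cd hb).
by apply: cornerN => b'; rewrite (corner_far hla hmu _ cd hb).
Qed.

Lemma umx_sq c : umx c * umx c = beta *: umx c.
Proof.
apply: mx_idxP => i J; rewrite [LHS]mul_umx [RHS]mxE -[umx c in RHS]mul1r [in RHS]mul_umx.
case: (cornerP c J) => [b hb|_]; last by rewrite mulr0.
rewrite -[umx c]mul1r !mul_umx (corner_onceE hb) (cornerS hla hmu hb) addr0.
by [].
Qed.

Lemma umx_far c d : (c.+1 < d)%N -> umx c * umx d = umx d * umx c.
Proof.
move=> cd; have cd1 : (c.+1 < d)%N || (d.+1 < c)%N by rewrite cd.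
have cd2 : (d.+1 < c)%N || (c.+1 < d)%N by rewrite orbC.
apply: mx_idxP => i J; rewrite -[umx c in LHS]mul1r -[umx d in RHS]mul1r !mul_umx.
case: (cornerP d J) => [b' hb'|nd]; rewrite ?mul_umx; case: (cornerP c J) => [b hb|nc] //;
  rewrite ?mul_umx.
- rewrite (corner_farE cd2 hb') (corner_farE cd1 hb) (cornerS hla hmu hb) (cornerS hla hmu hb').
  rewrite !mulrDr -!addrA; congr (_ + _); rewrite addrCA; congr (_ + (_ + _)).
  by rewrite finset.setDDl finset.setUC -finset.setDDl.
- by rewrite (corner_farE cd2 hb') (cornerN nc) mulr0 addr0.
- by rewrite (corner_farE cd1 hb) (cornerN nd) mulr0 addr0.
Qed.

(** By [corner_adjacent] and [corner_once] the terms with a factor [beta] from the first two columns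
    vanish. What is left removes three boxes of contents [c], [d], [c] in turn, which [corner_braid]
    excludes. *)
Lemma umx_braid c d : (d == c.+1) || (c == d.+1) -> (c != 0%N) || (d != 1%N) ->
  umx c * umx d * umx c = 0.
Proof.
move=> cd ncd; apply: mx_idxP => i J; rewrite [RHS]mxE -[umx c * _]mul1r -mulrA mulrA mulrA.
rewrite mul_umx; case: (cornerP c J) => [b1 h1|//].
rewrite !mul_umx (cornerN (fun b' => corner_adjacent hla hmu b' cd h1)) mulr0 add0r.
case: (cornerP d (J :\ b1)) => [b2 h2|//]; rewrite !mul_umx (corner_onceE h1) mulr0 add0r.
case: (cornerP c (J :\ b1 :\ b2)) => [b3 h3|//].
by have [e1 e2] := corner_braid hla hmu cd h1 h2 h3; rewrite e1 e2 in ncd.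
Qed.

Definition gv (W : seq step) (f : nat -> nat) : 'rV[{poly int}]_nstates.+1 :=
  \row_j gen W (st j) f.

Lemma gv_rcons W a c f : pairwise slt (rcons W (a, c)) ->
  gv (rcons W (a, c)) f = gv W f + (if (0 < f a.1)%N then gv W (decr f a.1) *m umx c else 0).
Proof.
move=> pW; apply: mx_idxP => i J; rewrite !mxE !idxK gen_rcons //; congr (_ + _).
case: ifP => _; last by rewrite mxE.
by rewrite mul_umx; case: corner => // b; rewrite !mxE !idxK.
Qed.

Lemma gv_eq0 W f k : (0 < f k)%N -> (forall t, t \in W -> t.1.1 != k) -> gv W f = 0.
Proof.
move=> fk Wk; apply/rowP => j; rewrite !mxE /gen fsbig1 // => T hT.
have := tab_lcount hT k; rewrite /lcount big1 => [e|u _]; first by rewrite -e in fk.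
rewrite big1_seq // => a /andP[_ aT]; apply/eqP; rewrite eqb0.
exact: (Wk _ (tab_step hT aT)).
Qed.

Lemma gv_nil f : (forall i, f i = 0%N) -> gv [::] f = delta_mx 0 (idx finset.set0).
Proof.
move=> f0; apply: mx_idxP => i J; rewrite !mxE idxK (ord1 i) /= /gen.
rewrite (can_eq idxK); pose T0 : filling la mu := [ffun=> fset0].
case: eqP => [->|J0]; last first.
  rewrite fsbig1 // => T hT; case: J0; apply/setP => u; rewrite inE -(tab_supp hT).
  by rewrite (tabs_nil hT) ffunE eqxx.
have -> : tabs [::] (finset.set0 : {set box}) f = [set T0]%classic.
  rewrite eqEsubset; split=> T /=; first by move=> /tabs_nil.
  move=> ->; split.
  - by apply/idealP => u v; rewrite inE.
  - by move=> u; rewrite ffunE inE eqxx.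
  - by move=> u a; rewrite ffunE inE.
  - by move=> u v a a' _; rewrite ffunE inE.
  - move=> k; rewrite f0 /lcount big1 // => u _.
    by rewrite big1_seq // => a; rewrite ffunE inE.
rewrite fsbig_set1 /tab_size big1 ?expr0 // => u _.
by rewrite ffunE cardfs0.
Qed.

Definition sub_at (f : nat -> nat) (k j i : nat) : nat := (f i - (if i == k then j else 0))%N.

(** Iterates [gv_rcons] along [B]; the index [j] counts the letters of value [k] placed by the steps
    of [B]. *)
Lemma gv_cat W B f k : pairwise slt (W ++ B) -> all (fun t : step => t.1.1 == k) B ->
  gv (W ++ B) f =
  \sum_(j < (f k).+1) gv W (sub_at f k j) *m ecoef [seq umx t.2 | t <- B] j.
Proof.
elim: B W f => [|[a c] B IH] W f.
  move=> _ _; rewrite cats0 big_ord_recl /= mulmx1 big1 ?addr0; last first.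
    by move=> i _; rewrite /= mulmx0.
  by congr gv; apply/funext => i; rewrite /sub_at; case: ifP; rewrite subn0.
rewrite -cat_rcons => pW /= /andP[/eqP ak aB]; rewrite (IH _ f pW aB).
have pW' : pairwise slt (rcons W (a, c)) by move: pW; rewrite pairwise_cat => /and3P[].
have E j := gv_rcons (sub_at f k j) pW'.
set w := [seq _ | _ <- B].
transitivity (\sum_(j < (f k).+1) (gv W (sub_at f k j) *m ecoef w j +
    (if (0 < sub_at f k j a.1)%N then gv W (decr (sub_at f k j) a.1) *m umx c else 0) *m ecoef w j)).
  by apply: eq_bigr => j _; rewrite E mulmxDl.
under [RHS]eq_bigr => j _ do rewrite /= -/w mulmxDr.
rewrite !big_split /=; congr (_ + _).
(* The term [j = f k] on the left has no letter left for the new step, and the term [j = 0] on the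
   right takes none from it; the others match after a shift by one. *)
rewrite big_ord_recr [RHS]big_ord_recl /= mulmx0 add0r.
have -> : sub_at f k (f k) a.1 = 0%N by rewrite /sub_at ak eqxx subnn.
rewrite ltnn mul0mx addr0; apply: eq_bigr => j _; rewrite /bump /= add1n mulmxA.
have -> : (0 < sub_at f k j a.1)%N by rewrite /sub_at ak eqxx subn_gt0.
congr (_ *m _ *m _); congr gv; apply/funext => i; rewrite /decr /sub_at ak.
by case: (i =P k); lia.
Qed.

(** No step of [W] has value [k], so all [f k] such letters are placed by [B]. *)
Lemma gv_block W B f k : pairwise slt (W ++ B) -> all (fun t : step => t.1.1 == k) B ->
  (forall t, t \in W -> t.1.1 != k) ->
  gv (W ++ B) f = gv W (sub_at f k (f k)) *m ecoef [seq umx t.2 | t <- B] (f k).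
Proof.
move=> pW aB Wk; rewrite (gv_cat _ pW aB) big_ord_recr /= big1 ?add0r // => j _.
by rewrite (@gv_eq0 _ _ k) ?mul0mx // /sub_at eqxx subn_gt0 ltn_ord.
Qed.

End Transfer.

(** * Reading words and the coefficients of GP and GQ *)

(* [gq] holds for GQ, where primed letters may occur on the diagonal. *)
Fixpoint sblock (gq : bool) (k n : nat) : seq step :=
  if n is n'.+1 then (primed k, n) :: rcons (sblock gq k n') (unprimed k, n)
  else if gq then [:: (primed k, 0%N); (unprimed k, 0%N)] else [:: (unprimed k, 0%N)].

Fixpoint cword (gq : bool) (n : nat) : seq nat :=
  if n is n'.+1 then n :: rcons (cword gq n') n
  else if gq then [:: 0%N; 0%N] else [:: 0%N].

Fixpoint steps (gq : bool) (n N : nat) : seq step :=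
  if N is N'.+1 then steps gq n N' ++ sblock gq N' n else [::].

Lemma sblock_cont gq k n : [seq t.2 | t <- sblock gq k n] = cword gq n.
Proof. by elim: n => [|n /= <-]; [case: gq | rewrite map_rcons]. Qed.

Lemma rev_cword gq n : rev (cword gq n) = cword gq n.
Proof. by elim: n => [|n IH]; [case: gq | rewrite /= rev_cons rev_rcons IH]. Qed.

Lemma mem_sblock gq k n a c : ((a, c) \in sblock gq k n) =
  [&& a.1 == k, (c <= n)%N & [|| gq, a.2 | (0 < c)%N]].
Proof.
case: a => i p; elim: n => [|n IH].
  rewrite leqn0; case: gq => /=; rewrite !inE /primed /unprimed !xpair_eqE;
  by case: (i =P k) => //= _; case: p => /=; lia.
rewrite /= inE mem_rcons inE IH /primed /unprimed !xpair_eqE /=; case: (i =P k) => //= _.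
by case: p {IH}; case: gq => /=; lia.
Qed.

Lemma pairwise_sblock gq k n : pairwise slt (sblock gq k n).
Proof.
elim: n => [|n IH]; first by case: gq; rewrite /= /slt ?eqxx ?ltnn.
rewrite /= pairwise_rcons IH andbT all_rcons -andbA; apply/and3P; split.
- by rewrite /slt /= eqxx ltnn.
- apply/allP => -[a c]; rewrite mem_sblock => /and3P[/eqP ak cn _].
  by rewrite /slt /= ak eqxx ltnn /= ltnS cn orbT.
apply/allP => -[a c]; rewrite mem_sblock => /and3P[/eqP ak cn _].
by rewrite /slt /= ak eqxx ltnn /= ltnS cn; case: a.2.
Qed.

Lemma mem_steps gq n N a c : ((a, c) \in steps gq n N) =
  [&& (a.1 < N)%N, (c <= n)%N & [|| gq, a.2 | (0 < c)%N]].
Proof.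
elim: N => [|N IH] //=; rewrite mem_cat IH mem_sblock -andb_orl; congr andb.
by rewrite ltnS [RHS]leq_eqVlt orbC.
Qed.

Lemma pairwise_steps gq n N : pairwise slt (steps gq n N).
Proof.
elim: N => [|N IH] //=; rewrite pairwise_cat IH pairwise_sblock !andbT.
apply/allrelP => -[a c] [a' c']; rewrite mem_steps mem_sblock => /andP[aN _] /andP[/eqP a'N _].
by rewrite /slt /= a'N aN.
Qed.

Section Coefficients.

Variables la mu : seq nat.
Hypotheses (hla : strict_partition la) (hmu : strict_partition mu) (hsub : part_sub mu la).

Notation box := (SD la mu).

Definition blk (gq : bool) (n k : nat) : 'M[{poly int}]_((nstates la mu).+1) :=
  ecoef [seq umx la mu c | c <- cword gq n] k.

Definition full_entry (M : 'M[{poly int}]_((nstates la mu).+1)) : {poly int} :=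
  M (idx finset.set0) (idx finset.setT).

Lemma gv_steps gq n N f : (forall i, (N <= i)%N -> f i = 0%N) ->
  gv la mu (steps gq n N) f = delta_mx 0 (idx finset.set0) *m \prod_(i < N) blk gq n (f i).
Proof.
elim: N f => [|N IH] f fN; first by rewrite big_ord0 mulmx1 gv_nil // => i; rewrite fN.
rewrite /= (@gv_block _ _ hla hmu _ _ _ N); first last.
- by move=> [a c]; rewrite mem_steps => /andP[aN _] /=; rewrite neq_ltn aN.
- by apply/allP => -[a c]; rewrite mem_sblock => /andP[].
- exact: (pairwise_steps gq n N.+1).
rewrite IH; last by move=> i iN; rewrite /sub_at; case: eqP => [->|/eqP h]; rewrite ?subnn // fN //; lia.
rewrite big_ord_recr /= -mulmxA; congr (_ *m (_ *m _)).
  apply: eq_bigr => i _; congr blk; rewrite /sub_at; case: eqP => h; last by rewrite subn0.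
  by have := ltn_ord i; rewrite h ltnn.
by rewrite /blk -(sblock_cont gq N n) -map_comp.
Qed.

Lemma tab_monE (T : filling la mu) i : tab_mon T i = lcount T i.
Proof.
have cmbig (I : Type) (r : seq I) (F : I -> {cmonom nat}) :
    (\big[mmul/@mone _]_(x <- r) F x) i = (\sum_(x <- r) F x i)%N.
  by elim: r => [|x r IH]; rewrite ?big_nil ?cm1 // !big_cons cmM IH.
rewrite /tab_mon cmbig; apply: eq_bigr => u _; rewrite cmbig.
by apply: eq_bigr => a _; rewrite cmU.
Qed.

Lemma sumn_nth (l : seq nat) k : (forall i, (k <= i)%N -> nth 0%N l i = 0%N) ->
  sumn l = (\sum_(i < k) nth 0 l i)%N.
Proof.
elim: l k => [|x l IH] [|k] h /=; rewrite ?big_ord0 //.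
- by rewrite big1 // => i _; rewrite nth_nil.
- have /= -> := h 0%N isT; rewrite (IH 0%N) ?big_ord0 // => i _.
  exact: (h i.+1).
by rewrite big_ord_recl /= (IH k) // => i ik; exact: (h i.+1).
Qed.

Lemma card_SD : #|(finset.setT : {set box})| = (sumn la - sumn mu)%N.
Proof.
rewrite cardsT -cardfE /SD card_fseq undup_id; last first.
  apply: allpairs_uniq_dep; first exact: iota_uniq.
    by move=> i _; exact: iota_uniq.
  move=> [i j] [i' j'] _ _ /= [-> /addnI ->] //.
rewrite size_allpairs_dep (@sumn_nth la (size la)) => [|i ?]; last by rewrite nth_default.
rewrite (@sumn_nth mu (size la)) => [|i hi]; last first.
  by have := hsub i; rewrite (nth_default _ hi) leqn0 => /eqP.
rewrite -sumnB => [|i _]; last exact: hsub.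
rewrite sumnE big_map -{1}(subn0 (size la)) big_mkord.
by apply: eq_bigr => i _; rewrite size_iota.
Qed.

Definition valid (gq : bool) (T : filling la mu) : Prop :=
  is_set_valued_tableau T /\ (~~ gq -> unprimed_diagonal T).

(** Equal letters in consecutive [slt] order need growing contents if unprimed and shrinking ones if
    primed, that is, a row or a column respectively. For GP the steps omit primed letters of content
    0, which is the diagonal condition. *)
Lemma tabs_valid gq n N (m : {cmonom nat}) (T : filling la mu) :
  (forall u : box, cont u <= n)%N -> (forall i, (N <= i)%N -> m i = 0%N) ->
  is_tab (steps gq n N) finset.setT m T <-> valid gq T /\ tab_mon T = m.
Proof.
move=> hn hN; split=> [hT|[[[h1 h2 h3 h4 h5] hd] hm]].
- have le1 (a a' : letter) c c' : slt (a, c) (a', c') -> (a <= a')%O.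
    by rewrite /slt letter_leE /=; case: a.2; case: a'.2 => /=; lia.
  split; last by apply/eqP/cmP => i; rewrite tab_monE (tab_lcount hT).
  split.
    split.
    + by move=> u; rewrite (tab_supp hT) inE.
    + move=> u v e lt a a' aT a'T; apply: (@le1 _ _ (cont u) (cont v)).
      by apply: (tab_slt hT _ aT a'T); rewrite /below /row /col e eqxx lt.
    + move=> u v e lt a a' aT a'T; apply: (@le1 _ _ (cont u) (cont v)).
      by apply: (tab_slt hT _ aT a'T); rewrite /below /row /col e eqxx lt orbT.
    + move=> u v i; wlog lt : u v / (row u < row v)%N => [wl|].
        move=> uv e; case: (ltngtP (row u) (row v)) => [lt||e'].
        * exact: (wl u v lt uv e).
        * by rewrite eq_sym in uv; move=> lt [hu hv]; exact: (wl v u lt uv (esym e)).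
        * by move/eqP: uv; case; apply: box_eq.
      move=> _ e [hu hv]; have e' : col u = col v := e.
      have uv : below u v by rewrite /below e' lt eqxx orbT.
      have := tab_slt hT uv hu hv; rewrite /slt /= ltnn eqxx /= /cont e'.
      by have := row_le_col v; lia.
    move=> u v i; wlog lt : u v / (col u < col v)%N => [wl|].
      move=> uv e; case: (ltngtP (col u) (col v)) => [lt||e'].
      + exact: (wl u v lt uv e).
      + by rewrite eq_sym in uv; move=> lt [hu hv]; exact: (wl v u lt uv (esym e)).
      + by move/eqP: uv; case; apply: box_eq.
    move=> _ e [hu hv]; have e' : row u = row v := e.
    have uv : below u v by rewrite /below e' lt eqxx.
    have := tab_slt hT uv hu hv; rewrite /slt /= ltnn eqxx /= /cont e'.
    by have := row_le_col u; lia.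
  move=> ngq u a e aT; have := tab_step hT aT.
  rewrite mem_steps (negPf ngq) /cont /row /col e subnn ltnn /= orbF.
  by move=> /andP[].
have fin a u : a \in T u -> (a.1 < N)%N.
  move=> aT; rewrite ltnNge; apply/negP => /hN; rewrite -hm tab_monE /lcount.
  move=> /eqP; rewrite sum_nat_eq0 => /forallP/(_ u); rewrite (big_fsetD1 a) //= eqxx.
  by [].
split.
- by apply/idealP => u v; rewrite !inE.
- by move=> u; rewrite h1 inE.
- move=> u a aT; rewrite mem_steps (fin _ _ aT) hn /=.
  case: gq hd => //= /(_ isT) hd; case: (posnP (cont u)) => [c0|]; last by rewrite orbT.
  have d : row u = col u by have := row_le_col u; move: c0; rewrite /cont; lia.
  by rewrite (hd u a d aT).
- move=> u v a a' /orP[|] /andP[/eqP e lt] aT a'T.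
  + have := h2 u v e lt a a' aT a'T; rewrite letter_leE /slt /=.
    have uv : u != v by apply: contraTneq lt => ->; rewrite ltnn.
    have c : (cont u < cont v)%N.
      have := row_le_col u; have := row_le_col v; move: e lt; rewrite /cont; lia.
    case/orP=> [-> //|/andP[/eqP e1]]; rewrite e1 ltnn eqxx c /=.
    have := h5 u v a'.1 uv e; case: a aT e1 => i p aT /= e1; case: a' a'T e1 => i' p' a'T /= e1.
    by rewrite e1 in aT; case: p aT; case: p' a'T => // hv hu hn2; case: hn2; split.
  have := h3 u v e lt a a' aT a'T; rewrite letter_leE /slt /=.
  have uv : u != v by apply: contraTneq lt => ->; rewrite ltnn.
  have c : (cont v < cont u)%N.
    have := row_le_col u; have := row_le_col v; move: e lt; rewrite /cont; lia.
  case/orP=> [-> //|/andP[/eqP e1]]; rewrite e1 ltnn eqxx c /= orbT.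
  have := h4 u v a'.1 uv e; case: a aT e1 => i p aT /= e1; case: a' a'T e1 => i' p' a'T /= e1.
  by rewrite e1 in aT; case: p aT; case: p' a'T => // hv hu hn2; case: hn2; split.
by move=> i; rewrite -hm tab_monE.
Qed.


Lemma GPQ_coef gq n N (m : {cmonom nat}) :
  (forall u : box, cont u <= n)%N -> (forall i, (N <= i)%N -> m i = 0%N) ->
  ssum [set T : filling la mu | valid gq T]%classic (@tab_term la mu) m =
  full_entry (\prod_(i < N) blk gq n (m i)).
Proof.
move=> hn hN; have := congr1 (fun M : 'rV_((nstates la mu).+1) => M 0 (idx finset.setT)) (@gv_steps gq n N m hN).
rewrite mxE idxK -rowE mxE /full_entry => <-; rewrite /gen card_SD /ssum.
have -> : tabs (steps gq n N) finset.setT m = ([set T | valid gq T] `&` [set T | tab_mon T = m])%classic.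
  by rewrite eqEsubset; split=> T /= => [/(tabs_valid gq T hn hN)|h]; last exact/(tabs_valid gq T hn hN).
rewrite [RHS]fsbig_mkcondr; apply: eq_fsbigr => T _; rewrite /tab_term /sscale /smono.
case: ifPn; rewrite ?inE ?notin_setE /= => h; first by rewrite h eqxx mulr1.
by case: eqP => [e|]; rewrite ?mulr0 //; case: h.
Qed.

End Coefficients.

(** * Commutation of the blocks *)

Lemma scalars_separate m n L (C : nat -> 'M[{poly int}]_(m, n)) :
  (forall x : {poly int}, \sum_(j < L) x ^+ j *: C j = 0) -> forall j, (j < L)%N -> C j = 0.
Proof.
move=> h j jL; apply/matrixP => i k; rewrite mxE.
pose p := \poly_(j < L) C j i k.
suff p0 : p = 0 by have := coef_poly L (fun j => C j i k) j; rewrite -/p p0 coef0 jL.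
apply/eqP/negPn/negP => pn0.
(* The distinct powers of [beta] are more roots than a nonzero polynomial over a domain can have. *)
pose rs := [seq ('X^e : {poly int}) | e <- iota 0 (size p)].
have : (size rs < size p)%N.
  apply: (max_poly_roots pn0).
    apply/allP => _ /mapP[e _ ->]; rewrite /root /p horner_poly; apply/eqP.
    have := congr1 (fun M : 'M_(m, n) => M i k) (h 'X^e); rewrite summxE mxE => e0.
    by rewrite -[RHS]e0; apply: eq_bigr => l _; rewrite mxE mulrC.
  rewrite map_inj_uniq ?iota_uniq // => a b /(congr1 (fun q : {poly int} => size q)).
  by rewrite !size_polyXn => -[].
by rewrite size_map size_iota ltnn.
Qed.

Section Commutation.

Variables la mu : seq nat.
Hypotheses (hla : strict_partition la) (hmu : strict_partition mu).

(** The blocks are the coefficients of [dress]. The dressed products commute up to a factor that can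
    be cancelled, and the coefficients are then separated in [x] and in [y]. *)
Lemma blk_comm gq n j k : blk la mu gq n j * blk la mu gq n k = blk la mu gq n k * blk la mu gq n j.
Proof.
pose p (x : {poly int}) := if gq then x + x + beta * x * x else x.
pose w := [seq umx la mu c | c <- cword gq n].
pose L := (size w).+1.
have dressE x : dress (umx la mu) p n x = \sum_(i < L) x ^+ i *: blk la mu gq n i.
  rewrite -ecoef_prod /w => {L w}; elim: n => [|m IH].
    rewrite /= /p; case: (gq); rewrite /= !big_cons big_nil mulr1 //.
    rewrite /hfac mulrDl !mulrDr !mul1r !mulr1 -!(scalerAl, scalerAr) umx_sq // !scalerA.
    by rewrite -!addrA -!scalerDl; congr (_ + _ *: _); ring.
  by rewrite /= big_cons map_rcons big_rcons /= mulrA -IH.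
have comm x y : dress (umx la mu) p n x * dress (umx la mu) p n y =
                dress (umx la mu) p n y * dress (umx la mu) p n x.
  (* The factor equals 1 at [beta = 0]. *)
  have nz : 1 + beta * x != 0.
    apply/eqP => /(congr1 (fun q : {poly int} => q.[0])).
    by rewrite hornerD hornerM /beta hornerX mul0r addr0 hornerC horner0.
  have sI (M N : 'M_((nstates la mu).+1)) : (1 + beta * x) *: M = (1 + beta * x) *: N -> M = N.
    by move=> /matrixP h; apply/matrixP => r c; have := h r c; rewrite 2!mxE => /(mulfI nz).
  apply: sI; apply: dress_comm_scaled.
  - by move=> c; exact: umx_sq.
  - by move=> c d; exact: umx_far.
  - by move=> c; apply: umx_braid => //; rewrite eqxx orbT.
  - by move=> c; apply: umx_braid => //; rewrite eqxx.
  - by move=> x' y' s; rewrite /s /p; case: (gq); ring.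
pose C j k := blk la mu gq n j * blk la mu gq n k - blk la mu gq n k * blk la mu gq n j.
have C0 : forall j, (j < L)%N -> forall k, (k < L)%N -> C j k = 0.
  move=> j' jL k' kL; apply: (@scalars_separate _ _ L (C j')) => // y.
  apply: (@scalars_separate _ _ L (fun i => \sum_(i' < L) y ^+ i' *: C i i')) => // x.
  rewrite -[RHS](subrr (dress (umx la mu) p n x * dress (umx la mu) p n y)) {2}comm !dressE.
  rewrite mulr_suml [X in _ - X]mulr_sumr -sumrB; apply: eq_bigr => i _.
  rewrite mulr_sumr mulr_suml -sumrB scaler_sumr; apply: eq_bigr => i' _.
  by rewrite -!(scalerAl, scalerAr) !scalerA mulrC -scalerBr.
case: (ltnP j L) => jL; last by rewrite /blk (ecoef_gt jL) mul0r mulr0.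
case: (ltnP k L) => kL; last by rewrite /blk (ecoef_gt kL) mul0r mulr0.
by apply/eqP; rewrite -subr_eq0; apply/eqP; exact: C0.
Qed.

End Commutation.

(** * The involution omega *)

Section Ribbons.

Variables (E : pzRingType) (b d : nat -> E).
Hypotheses (b0 : b 0%N = 1) (d0 : d 0%N = 1).
(** In generating functions, [B(-x) D(x) = 1]: [b] and [d] play the roles of complete and elementary
    symmetric functions. *)
Hypothesis bd : forall n, \sum_(i < n.+2) (-1) ^+ i * (b i * d (n.+1 - i)%N) = 0.
Hypothesis dC : forall i j, d i * d j = d j * d i.

(* Noncommutative ribbon Schur functions: a bit records whether a descent
   occurs, and [k] is the size of the current run. *)
Fixpoint ribbon (k : nat) (s : bitseq) : E :=
  match s with
  | [::] => b k
  | false :: s' => ribbon k.+1 s'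
  | true :: s' => b k * ribbon 1 s' - ribbon k.+1 s'
  end.

(* The product of [g] over the lengths of the runs cut out by [t]; the first
   run is lengthened by [k - 1] and the last one by [l]. *)
Fixpoint runs_prod (g : nat -> E) (k : nat) (t : bitseq) (l : nat) : E :=
  match t with
  | [::] => g (k + l)%N
  | false :: t' => runs_prod g k.+1 t' l
  | true :: t' => g k * runs_prod g 1 t' l
  end.

Fixpoint choices (cs : seq (seq bool)) : seq bitseq :=
  if cs is c :: cs' then [seq x :: s | x <- c, s <- choices cs'] else [:: [::]].

(** For [t] the strict ascents of a sorted word, [sub_bits t] lists the descent sets of the [Lqsym]
    in which the word occurs, and [sup_compl (rev t)] those of the compositions whose transposes
    have this property. *)
Definition sub_bits (t : bitseq) := choices [seq if x then [:: false; true] else [:: false] | x <- t].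
Definition sup_compl (t : bitseq) := choices [seq if x then [:: false; true] else [:: true] | x <- t].

Lemma choices_uniq cs : all uniq cs -> uniq (choices cs).
Proof.
elim: cs => //= c cs IH /andP[uc /IH u]; apply: allpairs_uniq => //.
by move=> [x s] [y s'] _ _ /= [-> ->].
Qed.

Lemma mem_choices cs s : (s \in choices cs) = all2 (fun x c => x \in c) s cs.
Proof.
elim: cs s => [|c cs IH] [|x s] //=; first by apply/negP => /allpairsP[[y s'] [_ _]].
rewrite -IH; apply/allpairsP/andP => [[[y s'] /= [yc sc [-> ->]]]|[xc sc]] //.
by exists (x, s).
Qed.

Lemma big_choices c cs (F : bitseq -> E) :
  \sum_(s <- choices (c :: cs)) F s = \sum_(x <- c) \sum_(s <- choices cs) F (x :: s).
Proof. by rewrite /= big_allpairs_dep. Qed.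

Lemma sub_bits_uniq t : uniq (sub_bits t).
Proof. by apply: choices_uniq; apply/allP => _ /mapP[[] _ ->]. Qed.

Lemma sup_compl_uniq t : uniq (sup_compl t).
Proof. by apply: choices_uniq; apply/allP => _ /mapP[[] _ ->]. Qed.

Lemma mem_sub_bits t s : s \in sub_bits t <->
  size s = size t /\ forall i, (i < size t)%N -> nth false s i -> nth false t i.
Proof.
rewrite mem_choices; elim: t s => [|y t IH] [|x s] /=.
- by split.
- by split=> // -[].
- by split=> // -[].
split=> [/andP[xy /IH[-> h]]|[[e] h]].
  by split=> // -[|i] /=; [move=> _; case: y x xy => -[] | exact: h].
apply/andP; split; last by apply/IH; split=> // i; exact: (h i.+1).
by have /= := h 0%N isT; case: x {h}; case: y => // /(_ isT).
Qed.

Lemma mem_sup_compl t s : s \in sup_compl t <->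
  size s = size t /\ forall i, (i < size t)%N -> ~~ nth false s i -> nth false t i.
Proof.
rewrite mem_choices; elim: t s => [|y t IH] [|x s] /=.
- by split.
- by split=> // -[].
- by split=> // -[].
split=> [/andP[xy /IH[-> h]]|[[e] h]].
  by split=> // -[|i] /=; [move=> _; case: y x xy => -[] | exact: h].
apply/andP; split; last by apply/IH; split=> // i; exact: (h i.+1).
by have /= := h 0%N isT; case: x {h}; case: y => // /(_ isT).
Qed.

(** Where both bits are allowed, the two ribbons add up to the product over the cut. *)
Lemma sum_sub_bits t k : \sum_(s <- sub_bits t) ribbon k s = runs_prod b k t 0.
Proof.
elim: t k => [|[] t IH] k; first by rewrite big_seq1 /= addn0.
  rewrite /sub_bits map_cons big_choices -/(sub_bits t) !big_cons big_nil addr0 /=.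
  by rewrite sumrB -mulr_sumr !IH addrC subrK.
by rewrite /sub_bits map_cons big_choices -/(sub_bits t) big_seq1 /= IH.
Qed.

(** The analogue of the expansion of the hook Schur function of shape [(k, 1^n)]. *)
Definition hook (k n : nat) : E := \sum_(i < n.+1) (-1) ^+ i * (b (k + i)%N * d (n - i)%N).

Lemma hook0 k : hook k 0 = b k.
Proof. by rewrite /hook big_ord1 mul1r addn0 d0 mulr1. Qed.

Lemma hook1 n : hook 1 n = d n.+1.
Proof.
have := bd n; rewrite big_ord_recl mul1r b0 mul1r subn0 => /(canRL (addrK _)).
rewrite add0r => ->; rewrite -sumrN; apply: eq_bigr => i _.
by rewrite /bump /= !add1n exprS subSS mulN1r mulNr opprK.
Qed.

Lemma hookS k n : hook k n.+1 = b k * hook 1 n - hook k.+1 n.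
Proof.
rewrite hook1 {1}/hook big_ord_recl mul1r addn0 subn0; congr (_ + _).
rewrite -sumrN; apply: eq_bigr => i _.
by rewrite lift0 exprS subSS mulN1r mulNr addnS addSn.
Qed.

Lemma runs_cat g k j t l : runs_prod g k (nseq j false ++ t) l = runs_prod g (k + j) t l.
Proof. by elim: j k => [|j IH] k /=; rewrite ?addn0 // IH addnS addSn. Qed.

Lemma sum_sup_compl_rec k t :
  \sum_(s <- sup_compl (true :: t)) ribbon k s = b k * \sum_(s <- sup_compl t) ribbon 1 s /\
  \sum_(s <- sup_compl (false :: t)) ribbon k s =
     b k * (\sum_(s <- sup_compl t) ribbon 1 s) - \sum_(s <- sup_compl t) ribbon k.+1 s.
Proof.
rewrite /sup_compl !map_cons !big_choices -/(sup_compl t) !big_cons !big_nil !addr0 /=.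
by rewrite sumrB -mulr_sumr addrC subrK.
Qed.

(** A run of [j] forced descents gives [hook k j], and a free bit splits off a factor. Every run
    starts with [k = 1], where [hook1] makes the hook a column [d j.+1]. *)
Lemma sum_sup_compl t : \sum_(s <- sup_compl t) ribbon 1 s = runs_prod d 1 t 0.
Proof.
have key j k t' : \sum_(s <- sup_compl (nseq j false ++ true :: t')) ribbon k s =
    hook k j * \sum_(s <- sup_compl t') ribbon 1 s.
  elim: j k => [|j IH] k /=; first by rewrite (sum_sup_compl_rec k t').1 hook0.
  by rewrite (sum_sup_compl_rec _ _).2 !IH hookS mulrBl mulrA.
have key0 j k : \sum_(s <- sup_compl (nseq j false)) ribbon k s = hook k j.
  elim: j k => [|j IH] k /=; first by rewrite big_seq1 hook0.
  by rewrite (sum_sup_compl_rec _ _).2 !IH hookS.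
have [n] := ubnP (size t); elim: n t => // n IH t.
have [j [->|[t' ->]]] : exists j, t = nseq j false \/ exists t', t = nseq j false ++ true :: t'.
  elim: t {IH} => [|[] t [j [->|[t' ->]]]]; first by exists 0%N; left.
  - by exists 0%N; right; exists (nseq j false).
  - by exists 0%N; right; exists (nseq j false ++ true :: t').
  - by exists j.+1; left.
  - by exists j.+1; right; exists t'.
- by move=> _; rewrite key0 hook1 -(cats0 (nseq j _)) runs_cat /= addn0.
rewrite size_cat /= => hn; rewrite key hook1 runs_cat /= IH //.
by move: hn; rewrite size_nseq; lia.
Qed.

Lemma runs_rconsF g k t l : runs_prod g k (rcons t false) l = runs_prod g k t l.+1.
Proof. by elim: t k => [|[] t IH] k /=; rewrite ?IH // addSnnS. Qed.

Lemma runs_rconsT g k t l : runs_prod g k (rcons t true) l = runs_prod g k t 0 * g l.+1.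
Proof. by elim: t k => [|[] t IH] k /=; rewrite ?IH ?mulrA // addn0 add1n. Qed.

Lemma runs_comm k t l i : d i * runs_prod d k t l = runs_prod d k t l * d i.
Proof. by elim: t k => [|[] t IH] k //=; rewrite mulrA dC -!mulrA IH. Qed.

(** Reversal exchanges the first and last runs, hence their extra lengths [k] and [l]; the factors
    commute. *)
Lemma runs_rev k t l : runs_prod d k.+1 (rev t) l = runs_prod d l.+1 t k.
Proof.
elim: t k l => [|[] t IH] k l /=; first by rewrite addSnnS addnC.
  by rewrite rev_cons runs_rconsT IH runs_comm.
by rewrite rev_cons runs_rconsF IH.
Qed.

End Ribbons.

Section RunsOfWords.

Variables (E : pzRingType) (g : nat -> E).
Hypothesis g0 : g 0%N = 1.

Lemma prod_absent m n w : all (fun y => n <= y)%N w ->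
  \prod_(m <= i < n) g (count_mem i w) = 1.
Proof.
move=> aw; rewrite big_nat_cond big1 // => i /andP[/andP[_ lt] _].
rewrite (_ : count_mem i w = 0%N) //; apply/count_memPn/negP => /(allP aw).
by rewrite leqNgt lt.
Qed.

Lemma runs_path k x w N : path leq x w -> all (fun y => y < N)%N (x :: w) ->
  runs_prod g k (pairmap ltn x w) 0 =
  g (k + count_mem x w)%N * \prod_(x.+1 <= i < N) g (count_mem i w).
Proof.
elim: w k x => [|y w IH] k x.
  by move=> _ _; rewrite /= big1 ?mulr1.
move=> pyw; have /= /andP[xy pw] := pyw; move=> /= /and3P[xN yN aN].
have aw := order_path_min leq_trans pw.
have := xy; rewrite leq_eqVlt => /predU1P[e|lt].
  subst y; rewrite ltnn (IH k.+1 x pw) /= ?xN // eqxx addSnnS; congr (_ * _).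
  by apply: eq_big_nat => i /andP[xi _]; rewrite (ltn_eqF xi).
rewrite lt (IH _ y) //= ?yN // (gtn_eqF lt) add0n.
have nx : count_mem x w = 0%N.
  by apply/count_memPn/negP => /(allP aw); rewrite leqNgt lt.
rewrite nx addn0; congr (_ * _).
rewrite [RHS](@big_cat_nat _ _ _ y) /= ?(ltnW yN) //.
have /= -> := @prod_absent x.+1 y (y :: w); last by rewrite /= leqnn.
rewrite mul1r [RHS]big_ltn // eqxx; congr (_ * _); apply: eq_big_nat => i /andP[yi _].
by rewrite (ltn_eqF yi).
Qed.

(** The strict ascents of a sorted word cut it into blocks of equal letters, and absent values
    contribute [g 0 = 1]. *)
Lemma runs_sorted x w N : path leq x w -> all (fun y => y < N)%N (x :: w) ->
  runs_prod g 1 (pairmap ltn x w) 0 = \prod_(i < N) g (count_mem (i : nat) (x :: w)).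
Proof.
move=> pw aN; rewrite (runs_path _ pw aN) -(big_mkord xpredT (fun i => g (count_mem i (x :: w)))).
have /= /andP[xN _] := aN; rewrite [RHS](@big_cat_nat _ _ _ x) /= ?(ltnW xN) //.
have /= -> := @prod_absent 0 x (x :: w); last first.
  by rewrite leqnn (order_path_min leq_trans pw).
rewrite mul1r [RHS]big_ltn // eqxx; congr (_ * _); apply: eq_big_nat => i /andP[yi _].
by rewrite (ltn_eqF yi).
Qed.

End RunsOfWords.

Local Open Scope classical_set_scope.
Local Open Scope ring_scope.

Lemma cmonom_support (m : {cmonom nat}) : exists N, forall i, (N <= i)%N -> m i = 0%N.
Proof.
exists (\max_(i <- finsupp m) i).+1 => i lei; apply/eqP; rewrite cmE_eq0.
apply/negP => im; have := @leq_bigmax_seq _ (enum_fset (finsupp m)) xpredT id i im isT.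
by rewrite /= leqNgt lei.
Qed.

Lemma cmonom_word (m : {cmonom nat}) : exists2 w, sorted leq w & word_mon w = m.
Proof.
have [N mN] := cmonom_support m.
exists (sort leq (flatten [seq nseq (m i) i | i <- iota 0 N])).
  by apply: sort_sorted; exact: leq_total.
apply/eqP/cmP => i; rewrite word_monE (permP (permEl (perm_sort _ _))).
rewrite count_flatten -map_comp sumnE big_map -{1}(subn0 N) big_mkord.
case: (ltnP i N) => iN.
  rewrite (bigD1 (Ordinal iN)) //= count_nseq /= eqxx mul1n big1 ?addn0 // => j.
  by rewrite -val_eqE /= count_nseq /= => /negPf ->.
rewrite big1 ?mN // => j _; rewrite /= count_nseq /=.
by case: eqP => // e; have := ltn_ord j; rewrite e ltnNge iN.
Qed.

Definition cbits (al : seq nat) : bitseq := [seq j \in comp_set al | j <- iota 1 (sumn al).-1].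
Definition comp_of_bits (n : nat) (s : bitseq) : seq nat := comp_of_set n (mask s (iota 1 n.-1)).

Lemma comp_of_bitsP n s : size s = n.-1 ->
  [/\ is_comp (comp_of_bits n s), sumn (comp_of_bits n s) = n & cbits (comp_of_bits n s) = s].
Proof.
move=> sz; have [] := @comp_of_setP n (mask s (iota 1 n.-1)).
- apply: (subseq_sorted ltn_trans (mask_subseq _ _)); exact: iota_ltn_sorted.
- by apply/allP => j /mem_mask; rewrite mem_iota; lia.
rewrite -/(comp_of_bits n s) => h1 h2 h3; split=> //.
rewrite /cbits h2 h3; have : uniq (iota 1 n.-1) := iota_uniq _ _.
rewrite -(size_iota 1 n.-1) in sz.
elim: s (iota 1 n.-1) sz {h1 h2 h3} => [|b s IH] [|x r] //= [sz] /andP[xr ur].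
have xm : x \notin mask s r by apply: contra xr; exact: mem_mask.
congr (_ :: _); first by case: b; rewrite ?mem_head // (negPf xm).
rewrite -[RHS](IH r sz ur); apply/eq_in_map => j jr; case: b => //.
by rewrite inE; case: eqP jr xr => // -> ->.
Qed.

Lemma cbitsK al : is_comp al -> comp_of_bits (sumn al) (cbits al) = al.
Proof.
move=> cal; have [sD aD] := comp_set_sorted cal.
rewrite /comp_of_bits /cbits -filter_mask -[RHS](comp_setK cal); congr comp_of_set.
apply: (irr_sorted_eq ltn_trans ltnn) => //.
  by apply: sorted_filter (iota_ltn_sorted _ _); exact: ltn_trans.
move=> j; rewrite mem_filter mem_iota; case jD: (j \in _) => //=.
by have := allP aD _ jD; lia.
Qed.

Lemma nth_cbits al i : (i < (sumn al).-1)%N -> nth false (cbits al) i = (i.+1 \in comp_set al).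
Proof. by move=> h; rewrite (nth_map 0%N) ?size_iota // nth_iota. Qed.

Lemma size_cbits al : size (cbits al) = (sumn al).-1.
Proof. by rewrite size_map size_iota. Qed.

Lemma fsum_comps n (L : seq bitseq) (F : seq nat -> {poly int}) :
  uniq L -> (forall s, s \in L -> size s = n.-1) ->
  \sum_(al \in [set al | is_comp al /\ (sumn al = n /\ cbits al \in L)]) F al =
  \sum_(s <- L) F (comp_of_bits n s).
Proof.
move=> uL sL.
have injL : {in L &, injective (comp_of_bits n)}.
  move=> s s' /sL /comp_of_bitsP[_ _ e] /sL /comp_of_bitsP[_ _ e'] ee.
  by rewrite -e ee e'.
rewrite -(big_map (comp_of_bits n) xpredT F) [RHS]fsbig_seq ?map_inj_in_uniq //.
rewrite (_ : [set al | _] = [set` [seq comp_of_bits n s | s <- L]])%classic //.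
rewrite eqEsubset; split=> al /=.
  by move=> [cal [<- bL]]; apply/mapP; exists (cbits al); rewrite ?cbitsK.
by move=> /mapP[s sL' ->]; have [? -> ->] := comp_of_bitsP (sL _ sL').
Qed.

Lemma mem_comp_set_rev be j : (j < sumn be)%N ->
  (j \in comp_set (rev be)) = ((sumn be - j)%N \in comp_set be).
Proof.
have sub al i : i \in comp_set (rev al) -> (sumn al - i)%N \in comp_set al.
  rewrite /comp_set size_rev => /mapP[k]; rewrite mem_iota => hk ->.
  apply/mapP; exists (size al - k)%N; first by rewrite mem_iota; lia.
  rewrite take_rev sumn_rev; have := congr1 sumn (cat_take_drop (size al - k) al).
  by rewrite sumn_cat; lia.
move=> hj; apply/idP/idP; first exact: sub.
move=> h; have := sub (rev be) (sumn be - j)%N; rewrite revK sumn_rev => /(_ h).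
by rewrite subKn // ltnW.
Qed.

Section Words.

Variables (x : nat) (w : seq nat).
Hypothesis pw : path leq x w.
Let t := pairmap ltn x w.

Lemma nth_ascents i : (i < size w)%N ->
  nth false t i = (nth 0 (x :: w) i < nth 0 (x :: w) i.+1)%N.
Proof. by move=> h; rewrite (nth_pairmap 0%N). Qed.

Lemma Lword_bits al : is_comp al ->
  Lword al (x :: w) <-> sumn al = (size w).+1 /\ cbits al \in sub_bits t.
Proof.
move=> cal; have [_ aD] := comp_set_sorted cal.
split=> [[sz _ h]|[sz /mem_sub_bits[_ h]]].
  split; first by rewrite -sz.
  apply/mem_sub_bits; rewrite size_pairmap size_cbits -sz; split=> // i hi.
  by rewrite nth_cbits -?sz // nth_ascents // => /h.
split=> // j jD; have := allP aD _ jD; case: j jD => // j jD /=; rewrite sz ltnS => js.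
rewrite -nth_ascents //; apply: h; rewrite ?size_pairmap //.
by rewrite nth_cbits ?sz.
Qed.

Lemma Lword_tr_bits al : is_comp al ->
  Lword (comp_tr al) (x :: w) <-> sumn al = (size w).+1 /\ cbits al \in sup_compl (rev t).
Proof.
move=> cal; have [c1 c2 c3] := comp_complP al.
have str : sumn (comp_tr al) = sumn al by rewrite /comp_tr sumn_rev c2.
have mtr j : (0 < j < sumn al)%N ->
    (j \in comp_set (comp_tr al)) = ((sumn al - j)%N \notin comp_set al).
  move=> hj; rewrite mem_comp_set_rev c2; last by lia.
  by rewrite c3 mem_filter mem_iota; case: (_ \in comp_set al) => //=; lia.
have trc : is_comp (comp_tr al) by rewrite /is_comp /comp_tr mem_rev.
have [_ aD] := comp_set_sorted trc; rewrite str in aD.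
have st : size t = size w by rewrite size_pairmap.
split=> [[]|[sz /mem_sup_compl[_ h]]].
  rewrite str /= => sz _ h; split=> //; apply/mem_sup_compl.
  rewrite size_rev size_cbits st -sz; split=> // i hi.
  rewrite nth_cbits -?sz // => ni; rewrite nth_rev st // nth_ascents; last by lia.
  have jD : (sumn al - i.+1)%N \in comp_set (comp_tr al).
    rewrite mtr; last by lia.
    by rewrite subKn //; lia.
  by have := h _ jD; rewrite -sz subSS -subnS [in nth _ _ _.+1](_ : _.+1 = (size w - i)%N) //; lia.
split; rewrite ?str // => j jD; have hj := allP aD _ jD.
move: jD; rewrite mtr // => jD; rewrite size_rev st in h.
have := h (sumn al - j).-1; rewrite nth_cbits; last by lia.
rewrite prednK ?jD; last by lia.
rewrite nth_rev st; last by lia.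
rewrite prednK; last by lia.
rewrite nth_ascents; last by lia.
have -> : (size w - (sumn al - j))%N = j.-1 by lia.
by rewrite prednK; [apply => //; lia | lia].
Qed.

End Words.

Lemma Lcomb_word c g w : sorted leq w ->
  Lcomb c (fun al => Lqsym (g al)) (word_mon w) =
  \sum_(al \in [set al | is_comp al /\ Lword (g al) w]) c al.
Proof.
move=> sw; rewrite /Lcomb /ssum /sscale.
have -> : [set al | is_comp al /\ Lword (g al) w] =
   ([set al | is_comp al] `&` [set al | Lword (g al) w])%classic by [].
rewrite [RHS]fsbig_mkcondr; apply: eq_fsbigr => al _.
rewrite Lqsym_word //; case: ifPn; rewrite ?inE ?notin_setE /= => h.
  by rewrite asboolT ?mulr1.
by rewrite asboolF ?mulr0.
Qed.

(** The coefficient of [f] on [Lqsym al] is the image of a ribbon. Summing ribbons over subsets of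
    the ascents of a word recovers products of [b], and summing over the transposed condition gives
    products of [d]. *)
Lemma omega_prod (E : pzRingType) (Phi : {additive E -> {poly int}}) (b d : nat -> E) (f : series) :
  b 0%N = 1 -> d 0%N = 1 ->
  (forall n, \sum_(i < n.+2) (-1) ^+ i * (b i * d (n.+1 - i)%N) = 0) ->
  (forall i j, d i * d j = d j * d i) ->
  (forall N (m : {cmonom nat}), (forall i, (N <= i)%N -> m i = 0%N) ->
     f m = Phi (\prod_(i < N) b (m i))) ->
  forall N (m : {cmonom nat}), (forall i, (N <= i)%N -> m i = 0%N) ->
     omega f m = Phi (\prod_(i < N) d (m i)).
Proof.
move=> b0 d0 bd dC fE.
(* The empty composition is separate: its bit string is empty, like that of the composition of 1,
   for which [ribbon] gives [b 1]. *)
pose c al := if sumn al is 0%N then Phi 1 else Phi (ribbon b 1 (cbits al)).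
(* Used twice: with [b] and [sub_bits] to expand [f], with [d] and [sup_compl (rev t)] to compute
   [omega f]. *)
have val (h : nat -> E) g (L : bitseq -> seq bitseq) :
    h 0%N = 1 -> g [::] = [::] -> (forall al, sumn (g al) = sumn al) ->
    (forall t, uniq (L t)) -> (forall t s, s \in L t -> size s = size t) ->
    (forall t, \sum_(s <- L t) ribbon b 1 s = runs_prod h 1 t 0) ->
    (forall x w al, path leq x w -> is_comp al ->
       Lword (g al) (x :: w) <-> sumn al = (size w).+1 /\ cbits al \in L (pairmap ltn x w)) ->
    forall N (m : {cmonom nat}), (forall i, (N <= i)%N -> m i = 0%N) ->
    Lcomb c (fun al => Lqsym (g al)) m = Phi (\prod_(i < N) h (m i)).
  move=> h0 gn sg uL sL LE LwE N m mN; have [w sw em] := cmonom_word m.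
  rewrite -{1}em (Lcomb_word _ _ sw); case: w sw em => [|x w] sw em.
    rewrite (_ : [set al | _] = [set [::]])%classic; last first.
      rewrite eqEsubset; split=> [al [cal [sz _ _]]|_ ->] /=; last first.
        by rewrite gn; split.
      move: sz; rewrite sg; case: al cal => // y al; rewrite /is_comp inE negb_or.
      by case: y.
    rewrite fsbig_set1 /c /= big1 // => i _.
    by rewrite -em word_monE.
  have aN : all (fun y => y < N)%N (x :: w).
    apply/allP => y yw; rewrite ltnNge; apply/negP => /mN /eqP.
    by rewrite -em word_monE; apply/negP; rewrite -lt0n -has_count has_pred1.
  transitivity (\sum_(al \in [set al | is_comp al /\
      (sumn al = (size w).+1 /\ cbits al \in L (pairmap ltn x w))]) c al).
    rewrite (_ : [set al | _ /\ Lword _ _] = [set al | is_comp al /\ (sumn al = (size w).+1 /\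
      cbits al \in L (pairmap ltn x w))])%classic //.
    by rewrite eqEsubset; split=> al [cal hal]; split=> //; apply/(LwE x w al sw cal).
  rewrite fsum_comps //; last by move=> s /sL; rewrite size_pairmap.
  transitivity (Phi (\sum_(s <- L (pairmap ltn x w)) ribbon b 1 s)).
    rewrite raddf_sum; apply: eq_big_seq => s /sL; rewrite size_pairmap => sz.
    by have [_ h1 h2] := @comp_of_bitsP (size w).+1 s sz; rewrite /c h1 h2.
  rewrite LE (runs_sorted h0 sw aN); congr (Phi _); apply: eq_bigr => i _.
  by rewrite -em word_monE.
have -> : f = Lcomb c Lqsym.
  apply/funext => m; have [N mN] := cmonom_support m; rewrite (fE _ _ mN).
  rewrite -(val b id sub_bits b0 erefl (fun=> erefl) sub_bits_uniq _ _ _ N m mN) //.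
  - by move=> t s /mem_sub_bits[].
  - by move=> t; exact: sum_sub_bits.
  - by move=> x w al pw; exact: Lword_bits.
rewrite omega_Lcomb => N m mN.
apply: (val d comp_tr (fun t => sup_compl (rev t)) d0 erefl _ _ _ _ _ N m mN) => //.
- by move=> al; rewrite /comp_tr sumn_rev; have [] := comp_complP al.
- by move=> t; exact: sup_compl_uniq.
- by move=> t s /mem_sup_compl[]; rewrite size_rev.
(* Commutativity of the [d i] undoes the reversal caused by the transpose. *)
- move=> t; rewrite (sum_sup_compl b0 d0 bd) runs_rev //.
- by move=> x w al pw; exact: Lword_tr_bits.
Qed.

(** * Coefficients of the substituted series *)

Lemma fsum_single (T : choiceType) (A : set T) (F : T -> {poly int}) x0 :
  A x0 -> (forall x, A x -> x <> x0 -> F x = 0) -> \sum_(x \in A) F x = F x0.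
Proof.
move=> Ax0 h; transitivity (\sum_(x \in [set x0]) F x); last exact: fsbig_set1.
apply/esym/fsbig_widen.
  by move=> x ->.
by move=> x [Ax nx]; exact: h.
Qed.

#[local] Arguments expcmn : simpl never.

Lemma expcmnE (i : nat) k j : expcmn (ucm i) k j = (if i == j then k else 0)%N.
Proof.
rewrite /expcmn; case: k => [|k]; first by rewrite onecmE if_same.
rewrite iteropS; elim: k => [|k IH] /=; first by rewrite ucmE; case: eqP.
by rewrite mulcmE IH ucmE; case: eqP.
Qed.

Definition supp_in (s : seq nat) (n : {cmonom nat}) : bool :=
  all (fun j => j \in s) (enum_fset (finsupp n)).

Lemma supp_inP s (n : {cmonom nat}) : reflect (forall j, j \notin s -> n j = 0%N) (supp_in s n).
Proof.
apply: (iffP allP) => [h j js|h j jn].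
  by apply/eqP; rewrite cmE_eq0; apply: contra js => /h.
by apply: contraT => /h /eqP; rewrite cmE_eq0 jn.
Qed.

Lemma supp_in1 (i : nat) (n : {cmonom nat}) : supp_in [:: i] n -> n = expcmn (ucm i) (n i).
Proof.
move=> /supp_inP h; apply/eqP/cmP => j; rewrite expcmnE; case: eqP => [->//|/eqP ij].
by rewrite h // inE eq_sym.
Qed.

Lemma supp_in_exp (i k : nat) : supp_in [:: i] (expcmn (ucm i) k).
Proof. by apply/supp_inP => j; rewrite inE expcmnE eq_sym => /negPf->. Qed.

Definition series1 (i : nat) (g : nat -> {poly int}) : series :=
  fun n => if supp_in [:: i] n then g (n i) else 0.

Lemma xgeomE i : xgeom i = series1 i (geom beta).
Proof.
apply/funext => n; rewrite /xgeom /ssum /series1 /sscale /smono.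
case: ifP => [hn|/negP hn]; last first.
  rewrite fsbig1 // => k _; case: eqP => [e|]; last by rewrite mulr0.
  by case: hn; rewrite e supp_in_exp.
case E: (n i) => [|l] /=.
  rewrite fsbig1 // => k _; case: eqP => [e|]; last by rewrite mulr0.
  by move: E; rewrite e expcmnE eqxx.
rewrite (@fsum_single _ _ _ l) //; first by rewrite [X in X == _](supp_in1 hn) E eqxx mulr1.
move=> k _ kl; case: eqP => [e|]; last by rewrite mulr0.
by move: E; rewrite e expcmnE eqxx => -[].
Qed.

Lemma smul_series1 i g h : smul (series1 i g) (series1 i h) = series1 i (conv g h).
Proof.
apply/funext => n; rewrite /smul.
case: (boolP (supp_in [:: i] n)) => hn; last first.
  rewrite fsbig1 => [|[a b] /= e]; first by rewrite /series1 (negPf hn).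
  rewrite /series1; case: ifP => [/supp_inP ha|]; last by rewrite mul0r.
  case: ifP => [/supp_inP hb|]; last by rewrite mulr0.
  by case/supp_inP: hn => j js; rewrite -e cmM ha ?hb.
pose pr (j : nat) := (expcmn (ucm i) j, expcmn (ucm i) (n i - j)%N).
have -> : [set ab : {cmonom nat} * {cmonom nat} | mmul ab.1 ab.2 = n] =
    pr @` [set j | (j <= n i)%N].
  rewrite eqEsubset; split=> [[a b] /= e|_ [j /= + <-]].
    have ab j : n j = (a j + b j)%N by rewrite -e cmM.
    have z j : j != i -> a j = 0%N /\ b j = 0%N.
      move=> ji; have /supp_inP/(_ j) := hn; rewrite inE => /(_ ji).
      by rewrite ab => /eqP; rewrite addn_eq0 => /andP[/eqP-> /eqP->].
    exists (a i); first by rewrite /= ab leq_addr.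
    rewrite /pr ab addKn; congr pair; apply/eqP/cmP => j; rewrite expcmnE;
      by case: eqP => [->//|/eqP ij]; have [] := z j; rewrite 1?eq_sym.
  move=> hj; apply/eqP/cmP => k; rewrite cmM !expcmnE.
  case: eqP => [<-|/eqP ik]; first by rewrite subnKC.
  by have /supp_inP -> := hn; rewrite // inE eq_sym.
rewrite fsbig_image; last first.
  move=> j j' _ _ [/eqP/cmP/(_ i)]; rewrite !expcmnE eqxx => ->; by [].
have -> : [set j | (j <= n i)%N] = [set` iota 0 (n i).+1].
  by apply/funext => j; apply/propext; rewrite /mkset mem_iota.
rewrite -fsbig_seq ?iota_uniq // /series1 hn /conv.
rewrite -(big_mkord xpredT (fun j => g j * h (n i - j)%N)) /index_iota subn0.
apply: eq_bigr => j _ /=.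
by rewrite !supp_in_exp !expcmnE eqxx.
Qed.

Lemma sone_series1 i : sone = series1 i (fun n => (n == 0%N)%:R).
Proof.
apply/funext => n; rewrite /sone /smono /series1.
case: ifP => hn; last first.
  case: eqP => // e; case/negP: hn; apply/supp_inP => j _; by rewrite e cm1.
congr ((nat_of_bool _)%:R); apply/eqP/eqP => [->|e]; first by rewrite cm1.
by rewrite (supp_in1 hn) e; apply/eqP/cmP => j; rewrite expcmnE if_same.
Qed.

Lemma sexp_xgeom i k : sexp (xgeom i) k = series1 i (gcoef beta k).
Proof.
rewrite /sexp /gcoef xgeomE (sone_series1 i); elim: k => //= k ->.
exact: smul_series1.
Qed.

(** The variables are distinct, so only one splitting of [n] between [x_i] and the remaining
    variables contributes. *)
Lemma big_smul_series1 (s : seq nat) (g : nat -> nat -> {poly int}) n : uniq s ->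
  (\big[smul/sone]_(i <- s) series1 i (g i)) n =
  if supp_in s n then \prod_(i <- s) g i (n i) else 0.
Proof.
elim: s n => [|i s IH] n.
  move=> _; rewrite big_nil /sone /smono big_nil.
  case: (boolP (supp_in [::] n)) => [/supp_inP h|/supp_inP h].
    by rewrite (_ : n = @mone _) ?eqxx //; apply/eqP/cmP => j; rewrite h // cm1.
  by case: eqP => // e; case: h => j _; rewrite e cm1.
move=> /= /andP[ins us]; rewrite big_cons.
pose a := expcmn (ucm i) (n i); pose b := divcm n a.
have bE j : b j = if i == j then 0%N else n j.
  by rewrite /b divcmE expcmnE; case: eqP => [->|]; rewrite ?subnn ?subn0.
have ab : mmul a b = n.
  by apply/eqP/cmP => j; rewrite cmM bE expcmnE; case: eqP => [->|]; rewrite ?addn0.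
rewrite /smul (@fsum_single _ _ _ (a, b)) //=; last first.
  move=> [a' b'] /= e ne; rewrite IH // /series1.
  case: ifP => [ha|]; last by rewrite mul0r.
  case: ifP => [/supp_inP hb|]; last by rewrite mulr0.
  case: ne; have ea : a' = a.
    rewrite (supp_in1 ha) /a; congr expcmn; rewrite -e cmM (hb i) ?addn0 //.
  congr pair => //; apply/eqP/cmP => j; have := congr1 (fun m : {cmonom nat} => m j) e.
  rewrite -[in RHS]ab !cmM ea; exact: addnI.
rewrite IH // {1}/series1 supp_in_exp expcmnE eqxx.
have -> : supp_in (i :: s) n = supp_in s b.
  apply/supp_inP/supp_inP => h j js.
    by rewrite bE; case: (eqVneq i j) => // ij; apply: h; rewrite inE eq_sym (negPf ij).
  move: js; rewrite inE negb_or eq_sym => /andP[/negPf ij /h].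
  by rewrite bE ij.
case: ifP => _; last by rewrite mulr0.
rewrite big_cons; congr (_ * _); apply: eq_big_seq => j js; rewrite bE.
by case: eqP => // e; rewrite e js in ins.
Qed.

(** [meval] runs over the variables of [m'] only. One that is absent from [m] kills the coefficient,
    as a positive power of [x / (1 - beta x)] has no constant term; so does a variable of [m] absent
    from [m']. *)
Lemma meval_xgeom (m' m : {cmonom nat}) N : (forall i, (N <= i)%N -> m i = 0%N) ->
  meval xgeom m' m =
  if supp_in (iota 0 N) m' then \prod_(i < N) gcoef beta (m' i) (m i) else 0.
Proof.
move=> mN; rewrite /meval; under eq_bigr do rewrite sexp_xgeom.
rewrite (@big_smul_series1 _ (fun i => gcoef beta (m' i))) ?fset_uniq //.
case: (boolP (supp_in (iota 0 N) m')) => [/supp_inP h|]; last first.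
  move=> /allPn[i im' iN]; case: ifP => // _.
  rewrite (big_rem i) //= mN; last by move: iN; rewrite mem_iota; lia.
  have : m' i != 0%N by rewrite cmE_neq0.
  by case: (m' i) => // k _; rewrite gcoef0S mul0r.
have -> : \prod_(i < N) gcoef beta (m' i) (m i) = \prod_(i <- iota 0 N) gcoef beta (m' i) (m i).
  by rewrite -(big_mkord xpredT (fun i => gcoef beta (m' i) (m i))) /index_iota subn0.
case: (boolP (supp_in _ m)) => [/supp_inP hm|/allPn[i im im']].
  rewrite [RHS](bigID (mem (finsupp m'))) /= [X in _ * X]big1 ?mulr1; last first.
    move=> i im'; rewrite (hm i im'); move: im'; rewrite -cmE_eq0 => /eqP->.
    by rewrite /gcoef.
  rewrite -[RHS]big_filter; apply: perm_big; apply: uniq_perm; rewrite ?fset_uniq ?filter_uniq ?iota_uniq //.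
  move=> i; rewrite mem_filter /= andbC; case: (boolP (i \in iota 0 N)) => //= iN.
  by apply/negbTE; rewrite -cmE_eq0 h.
have iN : i \in iota 0 N.
  rewrite mem_iota /= add0n ltnNge; apply/negP => /mN /eqP; rewrite cmE_eq0.
  by move/negP; apply.
rewrite (big_rem i) //= (_ : m' i = 0%N); last by apply/eqP; rewrite cmE_eq0.
have : m i != 0%N by rewrite cmE_neq0.
by rewrite /gcoef /=; case: (m i) => // k _; rewrite mul0r.
Qed.

Lemma big_mmulE (I : Type) (r : seq I) (F : I -> {cmonom nat}) i :
  (\big[mmul/@mone _]_(x <- r) F x) i = (\sum_(x <- r) F x i)%N.
Proof. by elim: r => [|x r IH]; rewrite ?big_nil ?cm1 // !big_cons cmM IH. Qed.

Definition ord_mon N M (phi : {ffun 'I_N -> 'I_M}) : {cmonom nat} :=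
  \big[mmul/@mone _]_(i < N) expcmn (ucm (i : nat)) (phi i).

Lemma ord_monE N M (phi : {ffun 'I_N -> 'I_M}) (i : 'I_N) : ord_mon phi i = phi i.
Proof.
rewrite /ord_mon big_mmulE (bigD1 i) //= expcmnE eqxx big1 ?addn0 // => j ji.
by rewrite expcmnE; case: eqP => // /val_inj e; rewrite e eqxx in ji.
Qed.

Lemma ord_mon_ge N M (phi : {ffun 'I_N -> 'I_M}) i : (N <= i)%N -> ord_mon phi i = 0%N.
Proof.
move=> Ni; rewrite /ord_mon big_mmulE big1 // => j _; rewrite expcmnE.
by case: eqP => // e; have := ltn_ord j; rewrite e ltnNge Ni.
Qed.

Lemma subst_geom_prod (E : algType {poly int}) (Phi : {additive E -> {poly int}})
    (b : nat -> E) (f : series) :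
  (forall a x, Phi (a *: x) = a * Phi x) ->
  (forall N (m : {cmonom nat}), (forall i, (N <= i)%N -> m i = 0%N) ->
     f m = Phi (\prod_(i < N) b (m i))) ->
  forall N (m : {cmonom nat}), (forall i, (N <= i)%N -> m i = 0%N) ->
     subst_geom f m = Phi (\prod_(i < N) geom_coef beta b (m i)).
Proof.
(* Since [gcoef beta k n = 0] for [n < k], only monomials in the first [N] variables with exponents
   below [M] contribute. The sum becomes finite, and distributivity factors it over the
   variables. *)
move=> PhiZ fE N m mN; pose M := (\max_(i < N) m i).+1.
have mM (i : 'I_N) : (m i < M)%N by rewrite ltnS (leq_bigmax i).
transitivity (\sum_(phi : {ffun 'I_N -> 'I_M})
    f (ord_mon phi) * \prod_(i < N) gcoef beta (phi i) (m i)); last first.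
  under [in RHS]eq_bigr => i _ do rewrite (geom_coefE beta b (mM i : (m i <= M.-1)%N)).
  rewrite bigA_distr_bigA raddf_sum; apply: eq_bigr => phi _.
  rewrite (fE N); last exact: ord_mon_ge.
  rewrite scaler_prod PhiZ mulrC; congr (_ * Phi _).
  by apply: eq_bigr => i _; rewrite ord_monE.
have injo : injective (@ord_mon N M).
  move=> phi psi /(congr1 (fun (n : {cmonom nat}) (i : 'I_N) => n i)) e.
  by apply/ffunP => i; apply: val_inj; rewrite /= -!ord_monE; exact: (congr1 (fun h => h i) e).
rewrite /subst_geom /ssubst /ssum /sscale.
transitivity (\sum_(m' \in (@ord_mon N M) @` [set` enum {: {ffun 'I_N -> 'I_M}}])
    f m' * meval xgeom m' m).
  apply/esym/fsbig_widen => // m' [_ nm']; rewrite /= (meval_xgeom m' mN).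
  case: ifP => [/supp_inP h|_]; last by rewrite mulr0.
  have [/forallP lt|] := boolP [forall i : 'I_N, (m' i < M)%N].
    case: nm'; exists [ffun i => Ordinal (lt i)]; first by rewrite /= mem_enum.
    apply/eqP/cmP => i; case: (ltnP i N) => iN.
      by have := ord_monE [ffun i => Ordinal (lt i)] (Ordinal iN); rewrite ffunE.
    by rewrite ord_mon_ge // h // mem_iota; lia.
  rewrite negb_forall => /existsP[i]; rewrite -leqNgt => hi.
  by rewrite (bigD1 i) //= gcoef_gt ?mul0r ?mulr0 //; apply: leq_trans hi.
rewrite fsbig_image; last by move=> ? ? _ _; exact: injo.
rewrite -fsbig_seq ?enum_uniq // big_enum; apply: eq_bigr => phi _ /=.
rewrite (meval_xgeom _ mN) ifT.
  by congr (_ * _); apply: eq_bigr => i _; rewrite ord_monE.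
by apply/supp_inP => j; rewrite mem_iota => nj; apply: ord_mon_ge; lia.
Qed.

(** * Comparison of the two sides *)

Lemma full_entry_is_zmod_morphism la mu : zmod_morphism (@full_entry la mu).
Proof. by move=> A B; rewrite /full_entry !mxE. Qed.

HB.instance Definition _ la mu :=
  GRing.isZmodMorphism.Build _ _ (@full_entry la mu) (@full_entry_is_zmod_morphism la mu).

Lemma omega_valid la mu gq : strict_partition la -> strict_partition mu -> part_sub mu la ->
  let f := ssum [set T : filling la mu | valid gq T] (@tab_term la mu) in
  omega f = subst_geom f.
Proof.
move=> hla hmu hsub f; pose n := (\max_(u : SD la mu) cont u)%N.
have hn (u : SD la mu) : (cont u <= n)%N by exact: leq_bigmax.
have fE N (m : {cmonom nat}) : (forall i, (N <= i)%N -> m i = 0%N) ->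
    f m = full_entry (\prod_(i < N) blk la mu gq n (m i)).
  exact: (GPQ_coef hla hmu hsub gq hn).
pose d := geom_coef beta (blk la mu gq n).
apply/funext => m; have [N mN] := cmonom_support m.
rewrite (subst_geom_prod _ fE mN); last by move=> a M; rewrite /= /full_entry mxE.
apply: (omega_prod _ _ _ _ fE mN).
- exact: ecoef0.
- by rewrite /geom_coef big_ord1 /gcoef scale1r /blk ecoef0.
(* The inverse of a product involves the reversed word of contents, which here is the same word. *)
- move=> k; have := @altconv_geom_coef _ beta _ [seq umx la mu c | c <- cword gq n] k.+1.
  rewrite -map_rev rev_cword; apply.
  by move=> _ /mapP[c _ ->]; exact: umx_sq.
- move=> i j; rewrite /geom_coef mulr_suml [RHS]mulr_sumr; apply: eq_bigr => k _.
  rewrite mulr_sumr [RHS]mulr_suml; apply: eq_bigr => l _.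
  by rewrite -!(scalerAl, scalerAr) !scalerA mulrC (blk_comm hla hmu).
Qed.

Theorem corollary6p5 (la mu : seq nat)
    (hla : strict_partition la) (hmu : strict_partition mu)
    (hsub : part_sub mu la) :
  omega (GP la mu) = subst_geom (GP la mu) /\
  omega (GQ la mu) = subst_geom (GQ la mu).
Proof.
have -> : GP la mu = ssum [set T : filling la mu | valid false T] (@tab_term la mu).
  rewrite /GP; congr ssum; apply/funext => T; apply/propext.
  by split=> -[h1 h2]; split=> //; exact: h2.
have -> : GQ la mu = ssum [set T : filling la mu | valid true T] (@tab_term la mu).
  rewrite /GQ; congr ssum; apply/funext => T; apply/propext.
  by split=> [h|[h _]] //; split.
by split; exact: omega_valid.
Qed.
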